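(* Let $(H,s)$ be a weak braiding operator over a field $k$. Then $(H,s)$ is a braiding operator if and only if its associated Hopf $q$-brace $(H,\cdot,\mathbin{:})$ is a Hopf skew-brace.
   Context: All vector spaces, maps and tensor products are over $k$ (maps are linear); Sweedler notation is used; $\mu,\eta,\epsilon$ are the multiplication, unit and counit of a Hopf algebra $H$; $H$ inside a tensor product of maps denotes $\mathrm{id}_H$; $H^{\mathrm{cop}}$, $H^{\mathrm{op}}$ denote opposite coalgebra/algebra. Multiplication in $H$ binds tighter than $\cdot$ and $\mathbin{:}$. A weak braiding operator is a pair $(H,s)$ of a Hopf algebra $H$ and a coalgebra endomorphism $s$ of $H\otimes H$ such that $(s\otimes H)(H\otimes s)(s\otimes H)=(H\otimes s)(s\otimes H)(H\otimes s)$, $s(\mu\otimes H)=(H\otimes\mu)(s\otimes H)(H\otimes s)$, $s(H\otimes\mu)=(\mu\otimes H)(H\otimes s)(s\otimes H)$, $s(\eta\otimes H)=H\otimes\eta$ and $s(H\otimes\eta)=\eta\otimes H$. It is a braiding operator if in addition $\mu=\mu\circ s$. Put ${}^hl:=(H\otimes\epsilon)s(h\otimes l)$, $h^l:=(\epsilon\otimes H)s(h\otimes l)$ and $G_s(h\otimes l):=h^{l_{(1)}}\otimes l_{(2)}$. If $(H,s)$ is a weak braiding operator, then $G_s$ is invertible, and with $h\cdot l:=(H\otimes\epsilon)G_s^{-1}(h\otimes l)$ and $h\mathbin{:}l:={}^{l\cdot h_{(1)}}h_{(2)}$ the triple $(H,\cdot,\mathbin{:})$ is a Hopf $q$-brace,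 called the Hopf $q$-brace associated with $(H,s)$. Hopf $q$-brace: a triple $(H,\cdot,\mathbin{:})$ with linear maps $\cdot,\mathbin{:}\colon H\otimes H\to H$ satisfying $\epsilon(x\cdot y)=\epsilon(x\mathbin{:}y)=\epsilon(x)\epsilon(y)$ such that: $H\otimes H^{\mathrm{cop}}\to H^{\mathrm{cop}}\otimes H$, $x\otimes y\mapsto y_{(1)}\mathbin{:}x_{(2)}\otimes x_{(1)}\cdot y_{(2)}$, is a coalgebra morphism; $x\otimes y\mapsto x\cdot y_{(1)}\otimes y_{(2)}$ is invertible; for all $x,y,z$: $(x\cdot y_{(1)})\cdot(z\mathbin{:}y_{(2)})=(x\cdot z_{(2)})\cdot(y\cdot z_{(1)})$, $(x\cdot y_{(1)})\mathbin{:}(z\cdot y_{(2)})=(x\mathbin{:}z_{(2)})\cdot(y\mathbin{:}z_{(1)})$, $(x\mathbin{:}y_{(1)})\mathbin{:}(z\mathbin{:}y_{(2)})=(x\mathbin{:}z_{(2)})\mathbin{:}(y\cdot z_{(1)})$; $H$ is a right $H^{\mathrm{op}}$-module via $\cdot$ and via $\mathbin{:}$; and $hm\cdot l=(h\cdot(l_{(1)}\mathbin{:}m_{(2)}))(m_{(1)}\cdot l_{(2)})$, $hm\mathbin{:}l=(h\mathbin{:}(l_{(1)}\cdot m_{(2)}))(m_{(1)}\mathbin{:}l_{(2)})$ for all $h,m,l\in H$. A Hopf skew-brace is a Hopf $q$-brace such that $(m\mathbin{:}h_{(2)})h_{(1)}=(h\cdot m_{(1)})m_{(2)}$ for all $h,m\in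 H$. *)

(* Defs.v *)
From HB Require Import structures.
From mathcomp Require Import all_boot all_order all_algebra.
From mathcomp Require Import boolp classical_sets.

Set Implicit Arguments.
Unset Strict Implicit.
Unset Printing Implicit Defensive.

Import GRing.Theory.
Local Open Scope ring_scope.
Local Open Scope quotient_scope.

Definition bilin (k : fieldType) (U V W : lmodType k) (f : U -> V -> W) : Prop :=
  bilinear_for *:%R *:%R f.

(* U ⊗ V is the space of formal sums of pairs, two of them being identified    *)
(* when no bilinear map separates them; see tlift_tens and tlift_unique for    *)
(* the universal property.                                                     *)
Section TensorProduct.
Variables (k : fieldType) (U V : lmodType k).

Definition teval (W : lmodType k) (f : U -> V -> W) (r : seq (U * V)) : W :=
  \sum_(p <- r) f p.1 p.2.

Definition tensor_eqv (r r' : seq (U * V)) : Prop :=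
  forall (W : lmodType k) (f : U -> V -> W), bilin f -> teval f r = teval f r'.

Definition tensor_rel : rel (seq (U * V)) := fun r r' => `[< tensor_eqv r r' >].

Lemma tensor_rel_refl : reflexive tensor_rel.
Proof. by move=> r; apply/asboolP. Qed.

Lemma tensor_rel_sym : symmetric tensor_rel.
Proof.
move=> r r'; apply/asboolP/asboolP => e W f bf; exact/esym/e.
Qed.

Lemma tensor_rel_trans : transitive tensor_rel.
Proof.
move=> r r' r'' /asboolP e1 /asboolP e2; apply/asboolP => W f bf.
by rewrite e1 // e2.
Qed.

Canonical tensor_equiv :=
  EquivRel tensor_rel tensor_rel_refl tensor_rel_sym tensor_rel_trans.

Definition tensor : Type := {eq_quot tensor_equiv}.

HB.instance Definition _ := Choice.on tensor.
HB.instance Definition _ := EqQuotient.on tensor.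

Definition tensor_of (r : seq (U * V)) : tensor := \pi_tensor r.
Definition tens (u : U) (v : V) : tensor := tensor_of [:: (u, v)].

(* The sum of f u v over a decomposition of t into pure tensors u ⊗ v, which   *)
(* depends on the chosen decomposition unless f is bilinear.                   *)
Definition tlift (W : lmodType k) (f : U -> V -> W) (t : tensor) : W :=
  teval f (repr t).

Lemma tlift_of (W : lmodType k) (f : U -> V -> W) r :
  bilin f -> tlift f (tensor_of r) = teval f r.
Proof.
move=> bf; rewrite /tlift /tensor_of.
case: piP => r' /eqmodP /asboolP e; exact/esym/e.
Qed.

Lemma tensorP (t t' : tensor) :
  (forall (W : lmodType k) (f : U -> V -> W), bilin f -> tlift f t = tlift f t') ->
  t = t'.
Proof.
move=> e; rewrite -[t]reprK -[t']reprK; apply/eqmodP/asboolP => W f bf.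
exact: e.
Qed.

Definition tensor_zero : tensor := tensor_of [::].
Definition tensor_add (t t' : tensor) : tensor := tensor_of (repr t ++ repr t').
Definition tensor_scale (a : k) (t : tensor) : tensor :=
  tensor_of [seq (a *: p.1, p.2) | p <- repr t].
Definition tensor_opp : tensor -> tensor := tensor_scale (-1).

Lemma bilin0l (W : lmodType k) (f : U -> V -> W) v : bilin f -> f 0 v = 0.
Proof.
move=> bf; have := bf.1 v (-1) 0 0; rewrite /= scaleN1r oppr0 addr0 => ->.
by rewrite scaleN1r addNr.
Qed.

Lemma bilinZl (W : lmodType k) (f : U -> V -> W) a u v :
  bilin f -> f (a *: u) v = a *: f u v.
Proof. by move=> bf; have := bf.1 v a u 0; rewrite /= addr0 bilin0l // addr0. Qed.

Lemma bilinDl (W : lmodType k) (f : U -> V -> W) u u' v :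
  bilin f -> f (u + u') v = f u v + f u' v.
Proof. by move=> bf; have := bf.1 v 1 u u'; rewrite /= !scale1r. Qed.

Lemma tlift0_subproof (W : lmodType k) (f : U -> V -> W) :
  bilin f -> tlift f tensor_zero = 0.
Proof. by move=> bf; rewrite tlift_of // /teval big_nil. Qed.

Lemma tliftD_subproof (W : lmodType k) (f : U -> V -> W) t t' :
  bilin f -> tlift f (tensor_add t t') = tlift f t + tlift f t'.
Proof. by move=> bf; rewrite tlift_of // /teval big_cat. Qed.

Lemma tliftZ_subproof (W : lmodType k) (f : U -> V -> W) a t :
  bilin f -> tlift f (tensor_scale a t) = a *: tlift f t.
Proof.
move=> bf; rewrite tlift_of // /teval big_map /= scaler_sumr.
by apply: eq_bigr => p _; rewrite bilinZl.
Qed.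

Let tE := (tliftD_subproof, tliftZ_subproof, tlift0_subproof).

Lemma tensor_addA : associative tensor_add.
Proof. by move=> x y z; apply: tensorP => W f bf; rewrite !tE // addrA. Qed.

Lemma tensor_addC : commutative tensor_add.
Proof. by move=> x y; apply: tensorP => W f bf; rewrite !tE // addrC. Qed.

Lemma tensor_add0 : left_id tensor_zero tensor_add.
Proof. by move=> x; apply: tensorP => W f bf; rewrite !tE // add0r. Qed.

Lemma tensor_addN : left_inverse tensor_zero tensor_opp tensor_add.
Proof.
by move=> x; apply: tensorP => W f bf; rewrite !tE // scaleN1r addNr.
Qed.

HB.instance Definition _ := GRing.isZmodule.Build tensor
  tensor_addA tensor_addC tensor_add0 tensor_addN.

Lemma tensor_scaleA a b x :
  tensor_scale a (tensor_scale b x) = tensor_scale (a * b) x.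
Proof. by apply: tensorP => W f bf; rewrite !tE // scalerA. Qed.

Lemma tensor_scale1 : left_id 1 tensor_scale.
Proof. by move=> x; apply: tensorP => W f bf; rewrite !tE // scale1r. Qed.

Lemma tensor_scaleDr : right_distributive tensor_scale +%R.
Proof. by move=> a x y; apply: tensorP => W f bf; rewrite !tE // scalerDr. Qed.

Lemma tensor_scaleDl x : {morph tensor_scale^~ x : a b / a + b}.
Proof. by move=> a b; apply: tensorP => W f bf; rewrite !tE // scalerDl. Qed.

HB.instance Definition _ := GRing.Zmodule_isLmodule.Build k tensor
  tensor_scaleA tensor_scale1 tensor_scaleDr tensor_scaleDl.

Lemma tens_bilin : bilin tens.
Proof.
split=> [v a u u'|u a v v']; apply: tensorP => W f bf;
  rewrite tliftD_subproof ?tliftZ_subproof // !tlift_of // /teval !big_seq1 /=.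
  exact: bf.1.
exact: bf.2.
Qed.

Lemma tlift_linear (W : lmodType k) (f : U -> V -> W) :
  bilin f -> linear (tlift f).
Proof. by move=> bf a x y; rewrite tliftD_subproof ?tliftZ_subproof. Qed.

Lemma tlift_tens (W : lmodType k) (f : U -> V -> W) u v :
  bilin f -> tlift f (tens u v) = f u v.
Proof. by move=> bf; rewrite tlift_of // /teval big_seq1. Qed.

Lemma tlift_id t : tlift tens t = t.
Proof.
apply: tensorP => W f bf; rewrite [tlift tens t]/tlift /teval.
have -> : tlift f t = \sum_(p <- repr t) f p.1 p.2 by [].
elim: (repr t) => [|p r IH]; first by rewrite !big_nil tlift0_subproof.
by rewrite !big_cons tliftD_subproof // tlift_tens // IH.
Qed.

Lemma tlift_unique (W : lmodType k) (f : U -> V -> W) (g : {linear tensor -> W}) :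
  (forall u v, g (tens u v) = f u v) -> g =1 tlift f.
Proof.
move=> e t; rewrite -[in LHS](tlift_id t) [in LHS]/tlift /teval linear_sum.
by apply: eq_bigr => p _; rewrite e.
Qed.

Lemma tlift_ext (W : lmodType k) (f f' : U -> V -> W) t :
  (forall u v, f u v = f' u v) -> tlift f t = tlift f' t.
Proof. by move=> e; apply: eq_bigr. Qed.

Lemma tensor_lin_ext (W : lmodType k) (f g : tensor -> W) :
  linear f -> linear g -> (forall u v, f (tens u v) = g (tens u v)) -> f =1 g.
Proof.
move=> lf lg e t.
pose F := GRing.isLinear.Build _ _ _ _ f lf.
pose F' : {linear tensor -> W} := HB.pack f F.
pose G := GRing.isLinear.Build _ _ _ _ g lg.
pose G' : {linear tensor -> W} := HB.pack g G.
apply: etrans (@tlift_unique W (fun u v => g (tens u v)) F' e t) _.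
exact/esym/(@tlift_unique W (fun u v => g (tens u v)) G').
Qed.

End TensorProduct.

Arguments tensor {k} (U V)%_type_scope.

Notation "U ⊗ V" := (tensor U V) (at level 40, left associativity) : type_scope.
Notation "u ⊗ v" := (tens u v) (at level 40, left associativity) : ring_scope.

(* Sweedler summation: t is written as a sum of pure tensors x ⊗ y.            *)
Notation "\tsum_ ( x , y <- t ) E" := (tlift (fun x y => E) t)
  (at level 41, x name, y name, t at level 99, E at level 41,
   format "\tsum_ ( x ,  y  <-  t )  E") : ring_scope.

Section Linearity.
Variable k : fieldType.
Implicit Types U V W X : lmodType k.

Lemma lin_bilin U V W (f : U -> V -> W) :
  (forall v, linear (fun u => f u v)) -> (forall u, linear (f u)) -> bilin f.
Proof. by move=> h1 h2; split=> ?; [exact: h1|exact: h2]. Qed.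

Lemma lin_id U : linear (fun u : U => u).
Proof. by []. Qed.

Lemma lin_comp U V W (f : {linear V -> W}) (g : U -> V) :
  linear g -> linear (fun u => f (g u)).
Proof. by move=> lg a x y; rewrite lg linearP. Qed.

Lemma lin_tlift_in U V W X (f : U -> V -> W) (g : X -> U ⊗ V) :
  linear g -> (forall v, linear (fun u => f u v)) -> (forall u, linear (f u)) ->
  linear (fun x => tlift f (g x)).
Proof. by move=> lg h1 h2 a x y; rewrite lg tlift_linear //; exact: lin_bilin. Qed.

Lemma lin_tlift_body U V W X (f : X -> U -> V -> W) t :
  (forall u v, linear (fun x => f x u v)) -> linear (fun x => tlift (f x) t).
Proof.
move=> h a x y; rewrite /tlift /teval scaler_sumr -big_split /=.
by apply: eq_bigr => p _; rewrite h.
Qed.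

Lemma lin_tensl U V X (f : X -> U) (v : V) :
  linear f -> linear (fun x => f x ⊗ v).
Proof. by move=> lf a x y; rewrite lf; exact: (tens_bilin U V).1. Qed.

Lemma lin_tensr U V X (u : U) (f : X -> V) :
  linear f -> linear (fun x => u ⊗ f x).
Proof. by move=> lf a x y; rewrite lf; exact: (tens_bilin U V).2. Qed.

Lemma lin_scalel V X (f : X -> k^o) (v : V) :
  linear f -> linear (fun x => f x *: v).
Proof. by move=> lf a x y; rewrite lf scalerDl scalerA. Qed.

Lemma lin_scaler V X (c : k) (f : X -> V) :
  linear f -> linear (fun x => c *: f x).
Proof. by move=> lf a x y; rewrite lf scalerDr !scalerA mulrC. Qed.

Lemma lin_mull (A : algType k) X (f : X -> A) (b : A) :
  linear f -> linear (fun x => f x * b).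
Proof. by move=> lf a x y; rewrite lf mulrDl scalerAl. Qed.

Lemma lin_mulr (A : algType k) X (b : A) (f : X -> A) :
  linear f -> linear (fun x => b * f x).
Proof. by move=> lf a x y; rewrite lf mulrDr scalerAr. Qed.

End Linearity.

Ltac lin :=
  intros;
  first
    [ exact: lin_id | assumption | solve [auto]
    | apply: lin_bilin; lin
    | apply: lin_tensl; lin | apply: lin_tensr; lin
    | apply: lin_scalel; lin | apply: lin_scaler; lin
    | apply: lin_mull; lin | apply: lin_mulr; lin
    | apply: lin_tlift_in; [lin|lin|lin]
    | apply: lin_tlift_body; lin
    | apply: lin_comp; lin ].

Section TensorMaps.
Variable k : fieldType.
Implicit Types U V W : lmodType k.

Definition tmap U V U' V' (f : U -> U') (g : V -> V') (t : U ⊗ V) : U' ⊗ V' :=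
  \tsum_(u, v <- t) f u ⊗ g v.

Lemma tmap_linear U V U' V' (f : {linear U -> U'}) (g : {linear V -> V'}) :
  linear (tmap f g).
Proof. by rewrite /tmap; lin. Qed.

HB.instance Definition _ U V U' V' (f : {linear U -> U'}) (g : {linear V -> V'}) :=
  GRing.isLinear.Build k _ _ _ (tmap f g) (tmap_linear f g).

Definition tassoc U V W (t : U ⊗ V ⊗ W) : U ⊗ (V ⊗ W) :=
  \tsum_(p, w <- t) \tsum_(u, v <- p) u ⊗ (v ⊗ w).

Lemma tassoc_linear U V W : linear (@tassoc U V W).
Proof. by rewrite /tassoc; lin. Qed.

HB.instance Definition _ U V W :=
  GRing.isLinear.Build k _ _ _ (@tassoc U V W) (@tassoc_linear U V W).

Definition tassocV U V W (t : U ⊗ (V ⊗ W)) : U ⊗ V ⊗ W :=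
  \tsum_(u, p <- t) \tsum_(v, w <- p) u ⊗ v ⊗ w.

Lemma tassocV_linear U V W : linear (@tassocV U V W).
Proof. by rewrite /tassocV; lin. Qed.

HB.instance Definition _ U V W :=
  GRing.isLinear.Build k _ _ _ (@tassocV U V W) (@tassocV_linear U V W).

Definition tswap U V (t : U ⊗ V) : V ⊗ U := \tsum_(u, v <- t) v ⊗ u.

Lemma tswap_linear U V : linear (@tswap U V).
Proof. by rewrite /tswap; lin. Qed.

HB.instance Definition _ U V :=
  GRing.isLinear.Build k _ _ _ (@tswap U V) (@tswap_linear U V).

Definition tmul (A : algType k) (t : A ⊗ A) : A := \tsum_(x, y <- t) x * y.

Lemma tmul_linear (A : algType k) : linear (@tmul A).
Proof. by rewrite /tmul; lin. Qed.

HB.instance Definition _ (A : algType k) :=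
  GRing.isLinear.Build k _ _ _ (@tmul A) (@tmul_linear A).

End TensorMaps.

HB.mixin Record Lmodule_isCoalgebra (k : fieldType) C of GRing.Lmodule k C := {
  comul : {linear C -> (C ⊗ C)%type};
  counit : {linear C -> k^o};
  comulA : forall x : C, tassoc (tmap comul idfun (comul x)) = tmap idfun comul (comul x);
  counitl : forall x : C, \tsum_(x1, x2 <- comul x) (counit x1 : k) *: x2 = x;
  counitr : forall x : C, \tsum_(x1, x2 <- comul x) (counit x2 : k) *: x1 = x
}.

#[short(type="coalgType")]
HB.structure Definition Coalgebra (k : fieldType) :=
  {C of GRing.Lmodule k C & Lmodule_isCoalgebra k C}.

HB.mixin Record isBialgebra (k : fieldType) H
    of GRing.Algebra k H & Lmodule_isCoalgebra k H := {
  comulM : forall x y : H, comul (x * y) =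
    \tsum_(x1, x2 <- comul x) \tsum_(y1, y2 <- comul y) (x1 * y1) ⊗ (x2 * y2);
  comul1 : comul (1 : H) = 1 ⊗ 1;
  counitM : forall x y : H, counit (x * y) = counit x * counit y :> k;
  counit1 : counit (1 : H) = 1 :> k
}.

#[short(type="bialgType")]
HB.structure Definition Bialgebra (k : fieldType) :=
  {H of GRing.Algebra k H & Coalgebra k H & isBialgebra k H}.

HB.mixin Record Bialgebra_isHopf (k : fieldType) H of Bialgebra k H := {
  antipode : {linear H -> H};
  antipodel : forall x : H, \tsum_(x1, x2 <- comul x) antipode x1 * x2 = (counit x : k) *: 1;
  antipoder : forall x : H, \tsum_(x1, x2 <- comul x) x1 * antipode x2 = (counit x : k) *: 1
}.

#[short(type="hopfAlgType")]
HB.structure Definition HopfAlgebra (k : fieldType) :=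
  {H of Bialgebra k H & Bialgebra_isHopf k H}.

Section CoalgebraTheory.
Variables (k : fieldType) (C : coalgType k).

Lemma linear_tlift (U V W W' : lmodType k) (g : {linear W -> W'})
    (f : U -> V -> W) t : g (tlift f t) = tlift (fun u v => g (f u v)) t.
Proof. by rewrite /tlift /teval linear_sum. Qed.

Lemma tlift_exchange (U V U' V' W : lmodType k) (f : U -> V -> U' -> V' -> W) t t' :
  \tsum_(u, v <- t) \tsum_(u', v' <- t') f u v u' v' =
  \tsum_(u', v' <- t') \tsum_(u, v <- t) f u v u' v'.
Proof. exact: exchange_big. Qed.

Lemma comulA_sum (W : lmodType k) (f : C -> C -> C -> W) (x : C) :
  (forall b c, linear (fun a => f a b c)) -> (forall a c, linear (fun b => f a b c)) ->
  (forall a b, linear (f a b)) ->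
  \tsum_(x1, x2 <- comul x) \tsum_(a, b <- comul x1) f a b x2 =
  \tsum_(x1, x2 <- comul x) \tsum_(a, b <- comul x2) f x1 a b.
Proof.
move=> f1 f2 f3; pose F (t : C ⊗ (C ⊗ C)) := \tsum_(a, p <- t) \tsum_(b, c <- p) f a b c.
have lF : linear F by rewrite /F; lin.
pose F' : {linear (C ⊗ (C ⊗ C))%type -> W} := HB.pack F (GRing.isLinear.Build _ _ _ _ F lF).
have FE a b c : F' (a ⊗ (b ⊗ c)) = f a b c.
  by rewrite /= /F tlift_tens ?tlift_tens //; lin.
have tassocE (t : C ⊗ C) c : tassoc (t ⊗ c) = \tsum_(a, b <- t) a ⊗ (b ⊗ c).
  by rewrite /tassoc tlift_tens //; lin.
have := congr1 F' (comulA x).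
rewrite [tmap comul idfun _]/tmap [tmap idfun comul _]/tmap.
rewrite (linear_tlift (@tassoc k C C C)) !(linear_tlift F') => e.
transitivity (\tsum_(u, v <- comul x) F' (tassoc (comul u ⊗ v))).
  apply: tlift_ext => u v; rewrite tassocE linear_tlift.
  by apply: tlift_ext => a b; rewrite FE.
rewrite e; apply: tlift_ext => u v.
by rewrite /= /F tlift_tens //; lin.
Qed.

End CoalgebraTheory.

Section TensorCoalgebra.
Variables (k : fieldType) (C D : coalgType k).

Definition tens_comul (t : C ⊗ D) : (C ⊗ D) ⊗ (C ⊗ D) :=
  \tsum_(c, d <- t) \tsum_(c1, c2 <- comul c) \tsum_(d1, d2 <- comul d)
    (c1 ⊗ d1) ⊗ (c2 ⊗ d2).

Lemma tens_comul_linear : linear tens_comul.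
Proof. by rewrite /tens_comul; lin. Qed.

HB.instance Definition _ :=
  GRing.isLinear.Build k _ _ _ tens_comul tens_comul_linear.

Definition tens_counit (t : C ⊗ D) : k^o :=
  \tsum_(c, d <- t) (counit c * counit d).

Lemma tens_counit_linear : linear tens_counit.
Proof. by rewrite /tens_counit; lin. Qed.

HB.instance Definition _ :=
  GRing.isLinear.Build k _ _ _ tens_counit tens_counit_linear.

Lemma tens_comulE c d : tens_comul (c ⊗ d) =
  \tsum_(c1, c2 <- comul c) \tsum_(d1, d2 <- comul d) (c1 ⊗ d1) ⊗ (c2 ⊗ d2).
Proof. by rewrite /tens_comul tlift_tens //; lin. Qed.

Lemma tens_counitE c d : tens_counit (c ⊗ d) = counit c * counit d.
Proof. by rewrite /tens_counit tlift_tens //; lin. Qed.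

Lemma tassoc_tens (U V W : lmodType k) (t : U ⊗ V) (w : W) :
  tassoc (t ⊗ w) = \tsum_(u, v <- t) u ⊗ (v ⊗ w).
Proof. by rewrite /tassoc tlift_tens //; lin. Qed.

Lemma tmap_tens (U V U' V' : lmodType k) (f : {linear U -> U'})
    (g : {linear V -> V'}) u v : tmap f g (u ⊗ v) = f u ⊗ g v.
Proof. by rewrite /tmap tlift_tens //; lin. Qed.

Lemma tlift_tlift (U V U' V' W : lmodType k) (f : U' -> V' -> W)
    (g : U -> V -> U' ⊗ V') t : bilin f ->
  tlift f (tlift g t) = \tsum_(u, v <- t) tlift f (g u v).
Proof.
move=> bf; pose F : {linear (U' ⊗ V')%type -> W} :=
  HB.pack (tlift f) (GRing.isLinear.Build _ _ _ _ (tlift f) (tlift_linear bf)).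
exact: (linear_tlift F).
Qed.

Lemma tensZ (U V : lmodType k) a b (u : U) (v : V) :
  (a *: u) ⊗ (b *: v) = (a * b) *: (u ⊗ v).
Proof.
rewrite (bilinZl _ _ _ (tens_bilin U V)) -scalerA; congr (_ *: _).
have := (tens_bilin U V).2 u b v 0; rewrite /= addr0 => ->.
have := (tens_bilin U V).2 u (-1) 0 0; rewrite /= scaleN1r oppr0 addr0 => ->.
by rewrite scaleN1r addNr addr0.
Qed.

Lemma tens_tlift (U V U' V' W W' : lmodType k) (f : U -> V -> W)
    (f' : U' -> V' -> W') t t' :
  tlift f t ⊗ tlift f' t' =
  \tsum_(u, v <- t) \tsum_(u', v' <- t') f u v ⊗ f' u' v'.
Proof.
pose R w : {linear W' -> (W ⊗ W')%type} := HB.pack (tens w)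
  (GRing.isLinear.Build _ _ _ _ _ (@lin_tensr k _ _ _ w _ (@lin_id _ _))).
pose L (w : W') : {linear W -> (W ⊗ W')%type} := HB.pack (fun x : W => x ⊗ w)
  (GRing.isLinear.Build _ _ _ _ _ (@lin_tensl k _ _ _ _ w (@lin_id _ _))).
apply: etrans (linear_tlift (L (tlift f' t')) f t) _.
apply: tlift_ext => u v /=.
exact: (linear_tlift (R (f u v)) f' t').
Qed.

Lemma linear_tens_comul (W : lmodType k)
    (f : {linear ((C ⊗ D) ⊗ (C ⊗ D))%type -> W}) c d :
  f (tens_comul (c ⊗ d)) =
  \tsum_(c1, c2 <- comul c) \tsum_(d1, d2 <- comul d) f ((c1 ⊗ d1) ⊗ (c2 ⊗ d2)).
Proof.
rewrite tens_comulE linear_tlift; apply: tlift_ext => c1 c2.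
by rewrite linear_tlift.
Qed.

Lemma tens_comulA t :
  tassoc (tmap tens_comul idfun (tens_comul t)) =
  tmap idfun tens_comul (tens_comul t).
Proof.
move: t; apply: tensor_lin_ext; [by lin|by lin|move=> c d].
apply: etrans
  (linear_tens_comul (@tassoc _ _ _ _ \o tmap tens_comul idfun) c d) _.
apply: etrans (esym (linear_tens_comul (tmap idfun tens_comul) c d)).
pose G c1 c2 c3 d1 d2 d3 : (C ⊗ D) ⊗ ((C ⊗ D) ⊗ (C ⊗ D)) :=
  (c1 ⊗ d1) ⊗ ((c2 ⊗ d2) ⊗ (c3 ⊗ d3)).
transitivity (\tsum_(c1, c2 <- comul c) \tsum_(a, b <- comul c1)
    \tsum_(d1, d2 <- comul d) \tsum_(a', b' <- comul d1) G a b c2 a' b' d2).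
  apply: tlift_ext => c1 c2; rewrite [RHS]tlift_exchange.
  apply: tlift_ext => d1 d2; rewrite /= tmap_tens tassoc_tens /= tens_comulE.
  rewrite tlift_tlift; last by lin.
  apply: tlift_ext => a b; rewrite tlift_tlift; last by lin.
  by apply: tlift_ext => a' b'; rewrite tlift_tens //; lin.
transitivity (\tsum_(c1, c2 <- comul c) \tsum_(a, b <- comul c2)
    \tsum_(d1, d2 <- comul d) \tsum_(a', b' <- comul d2) G c1 a b d1 a' b').
  rewrite -comulA_sum; try by rewrite /G; lin.
  apply: tlift_ext => c1 c2; apply: tlift_ext => a b.
  by rewrite comulA_sum //; rewrite /G; lin.
apply: tlift_ext => c1 c2; rewrite tlift_exchange.
apply: tlift_ext => d1 d2; rewrite /= tmap_tens /=.
pose F : {linear ((C ⊗ D) ⊗ (C ⊗ D))%type -> ((C ⊗ D) ⊗ ((C ⊗ D) ⊗ (C ⊗ D)))%type} :=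
  HB.pack (fun p => (c1 ⊗ d1) ⊗ p) (GRing.isLinear.Build _ _ _ _ _
    (@lin_tensr k _ _ _ (c1 ⊗ d1) _ (@lin_id _ _))).
exact: esym (linear_tens_comul F c2 d2).
Qed.

Lemma tens_counitl t : \tsum_(p, q <- tens_comul t) (tens_counit p : k) *: q = t.
Proof.
move: t; apply: tensor_lin_ext => [||c d]; [by lin|by lin|].
rewrite tens_comulE tlift_tlift; last by lin.
rewrite -[in RHS](counitl c) -[in RHS](counitl d).
transitivity (\tsum_(c1, c2 <- comul c) \tsum_(d1, d2 <- comul d)
    (((counit (c1 : C) : k) *: (c2 : C)) ⊗ ((counit (d1 : D) : k) *: (d2 : D)))).
  apply: tlift_ext => c1 c2; rewrite tlift_tlift; last by lin.
  apply: tlift_ext => d1 d2; rewrite tlift_tens; last by lin.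
  by rewrite tens_counitE tensZ.
by rewrite tens_tlift.
Qed.

Lemma tens_counitr t : \tsum_(p, q <- tens_comul t) (tens_counit q : k) *: p = t.
Proof.
move: t; apply: tensor_lin_ext => [||c d]; [by lin|by lin|].
rewrite tens_comulE tlift_tlift; last by lin.
rewrite -[in RHS](counitr c) -[in RHS](counitr d).
transitivity (\tsum_(c1, c2 <- comul c) \tsum_(d1, d2 <- comul d)
    (((counit (c2 : C) : k) *: (c1 : C)) ⊗ ((counit (d2 : D) : k) *: (d1 : D)))).
  apply: tlift_ext => c1 c2; rewrite tlift_tlift; last by lin.
  apply: tlift_ext => d1 d2; rewrite tlift_tens; last by lin.
  by rewrite tens_counitE tensZ.
by rewrite tens_tlift.
Qed.

HB.instance Definition _ := Lmodule_isCoalgebra.Build k (C ⊗ D)%type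
  tens_comulA tens_counitl tens_counitr.

End TensorCoalgebra.

Definition cop (C : Type) : Type := C.
Notation "C ^cop" := (cop C) (at level 2, format "C ^cop") : type_scope.

Section CoopositeCoalgebra.
Variables (k : fieldType) (C : coalgType k).

HB.instance Definition _ := GRing.Lmodule.on C^cop.

Definition cop_comul (x : C^cop) : C^cop ⊗ C^cop := tswap (comul (x : C)).
Definition cop_counit (x : C^cop) : k^o := counit (x : C).

Lemma cop_comul_linear : linear cop_comul.
Proof. by move=> a x y; rewrite /cop_comul !linearP. Qed.

HB.instance Definition _ :=
  GRing.isLinear.Build k C^cop (C^cop ⊗ C^cop)%type *:%R cop_comul cop_comul_linear.

Lemma cop_counit_linear : linear cop_counit.
Proof. by move=> a x y; rewrite /cop_counit linearP. Qed.

HB.instance Definition _ :=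
  GRing.isLinear.Build k C^cop k^o *:%R cop_counit cop_counit_linear.

Lemma linear_cop_comul (W : lmodType k)
    (f : {linear (C^cop ⊗ C^cop)%type -> W}) x :
  f (cop_comul x) =
  \tsum_(x1, x2 <- comul (x : C)) f ((x2 : C^cop) ⊗ (x1 : C^cop)).
Proof. by rewrite /cop_comul /tswap linear_tlift. Qed.

Lemma cop_comulA x :
  tassoc (tmap cop_comul idfun (cop_comul x)) = tmap idfun cop_comul (cop_comul x).
Proof.
apply: etrans
  (linear_cop_comul (@tassoc _ _ _ _ \o tmap cop_comul idfun) x) _.
apply: etrans (esym (linear_cop_comul (tmap idfun cop_comul) x)).
transitivity (\tsum_(x1, x2 <- comul (x : C)) \tsum_(a, b <- comul x2)
    ((b : C^cop) ⊗ ((a : C^cop) ⊗ (x1 : C^cop)))).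
  apply: tlift_ext => u v; rewrite /= tmap_tens tassoc_tens /=.
  rewrite /cop_comul /tswap tlift_tlift; last by lin.
  by apply: tlift_ext => a b; rewrite tlift_tens //; lin.
rewrite -(@comulA_sum _ C _ (fun a b c : C =>
  ((c : C^cop) ⊗ ((b : C^cop) ⊗ (a : C^cop))))); try by lin.
apply: tlift_ext => u v; rewrite /= tmap_tens /=.
pose F : {linear (C^cop ⊗ C^cop)%type -> (C^cop ⊗ (C^cop ⊗ C^cop))%type} :=
  HB.pack (fun p => (v : C^cop) ⊗ p) (GRing.isLinear.Build _ _ _ _ _
    (@lin_tensr k _ _ _ (v : C^cop) _ (@lin_id _ _))).
exact: esym (linear_cop_comul F u).
Qed.

Lemma cop_counitl x : \tsum_(x1, x2 <- cop_comul x) (cop_counit x1 : k) *: x2 = x.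
Proof.
rewrite /cop_comul /tswap tlift_tlift; last by lin.
rewrite -[RHS](counitr (x : C)); apply: tlift_ext => u v.
by rewrite tlift_tens //; lin.
Qed.

Lemma cop_counitr x : \tsum_(x1, x2 <- cop_comul x) (cop_counit x2 : k) *: x1 = x.
Proof.
rewrite /cop_comul /tswap tlift_tlift; last by lin.
rewrite -[RHS](counitl (x : C)); apply: tlift_ext => u v.
by rewrite tlift_tens //; lin.
Qed.

HB.instance Definition _ :=
  Lmodule_isCoalgebra.Build k C^cop cop_comulA cop_counitl cop_counitr.

End CoopositeCoalgebra.

Definition coalg_morphism (k : fieldType) (C D : coalgType k)
    (f : {linear C -> D}) : Prop :=
  (forall x, comul (f x) = tmap f f (comul x)) /\
  (forall x, counit (f x) = counit x :> k).

Section LinearInverse.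
Variables (k : fieldType) (U V : lmodType k).

(* The inverse of f when f is bijective, and 0 otherwise.                      *)
Definition lininv (f : U -> V) (v : V) : U :=
  if `[< bijective f >] then xget 0 [set u | f u = v]%classic else 0.

Lemma lininvK (f : U -> V) : bijective f -> cancel f (lininv f).
Proof.
move=> bf u; rewrite /lininv asboolT //; case: xgetP => [u' _|/(_ u)] //=.
exact: (bij_inj bf).
Qed.

Lemma lininvKV (f : U -> V) : bijective f -> cancel (lininv f) f.
Proof. by move=> bf v; case: (bf) => g _ gK; rewrite -[v]gK lininvK. Qed.

Lemma lininv_linear (f : {linear U -> V}) : linear (lininv f).
Proof.
have [bf|nbf] := pselect (bijective f); last first.
  by move=> a x y; rewrite /lininv asboolF // scaler0 addr0.
by move=> a x y; apply: (bij_inj bf); rewrite linearP !lininvKV.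
Qed.

HB.instance Definition _ (f : {linear U -> V}) :=
  GRing.isLinear.Build k _ _ _ (lininv f) (lininv_linear f).

End LinearInverse.

Section WeakBraiding.
Variables (k : fieldType) (H : hopfAlgType k).
Variable s : {linear (H ⊗ H)%type -> (H ⊗ H)%type}.

Definition braid12 : H ⊗ H ⊗ H -> H ⊗ H ⊗ H := tmap s idfun.
Definition braid23 : H ⊗ H ⊗ H -> H ⊗ H ⊗ H :=
  @tassocV _ _ _ _ \o tmap idfun s \o @tassoc _ _ _ _.

Record weak_braiding_operator : Prop := {
  wb_coalg : coalg_morphism s;
  wb_braid : forall t,
    braid12 (braid23 (braid12 t)) = braid23 (braid12 (braid23 t));
  wb_mull : forall t : H ⊗ H ⊗ H,
    s (tmap (@tmul k H) idfun t) =
    tmap idfun (@tmul k H) (tassoc (braid12 (braid23 t)));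
  wb_mulr : forall t : H ⊗ H ⊗ H,
    s (tmap idfun (@tmul k H) (tassoc t)) =
    tmap (@tmul k H) idfun (braid23 (braid12 t));
  wb_unitl : forall h : H, s (1 ⊗ h) = h ⊗ 1;
  wb_unitr : forall h : H, s (h ⊗ 1) = 1 ⊗ h
}.

Definition braiding_operator : Prop :=
  weak_braiding_operator /\ (forall t, tmul (s t) = tmul t).

Definition lact (h l : H) : H := \tsum_(x, y <- s (h ⊗ l)) (counit y : k) *: x.
Definition ract (h l : H) : H := \tsum_(x, y <- s (h ⊗ l)) (counit x : k) *: y.

Definition braid_G (t : H ⊗ H) : H ⊗ H :=
  \tsum_(h, l <- t) \tsum_(l1, l2 <- comul l) ract h l1 ⊗ l2.

Lemma braid_G_linear : linear braid_G.
Proof. by rewrite /braid_G /ract; lin. Qed.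

HB.instance Definition _ :=
  GRing.isLinear.Build k _ _ _ braid_G braid_G_linear.

(* braid_G is bijective as soon as s is a weak braiding operator.              *)
Definition assoc_dot (t : H ⊗ H) : H :=
  \tsum_(x, y <- lininv braid_G t) (counit y : k) *: x.

Lemma assoc_dot_linear : linear assoc_dot.
Proof. by rewrite /assoc_dot; lin. Qed.

HB.instance Definition _ :=
  GRing.isLinear.Build k _ _ _ assoc_dot assoc_dot_linear.

Definition assoc_colon (t : H ⊗ H) : H :=
  \tsum_(h, l <- t) \tsum_(h1, h2 <- comul h) lact (assoc_dot (l ⊗ h1)) h2.

Lemma assoc_colon_linear : linear assoc_colon.
Proof. by rewrite /assoc_colon /lact; lin. Qed.

HB.instance Definition _ :=
  GRing.isLinear.Build k _ _ _ assoc_colon assoc_colon_linear.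

End WeakBraiding.

(* Bilinearity of act is not part of this predicate: it is only used for       *)
(* actions induced by a linear map on a tensor product.                        *)
Definition right_module_action (k : fieldType) (A : nzRingType) (M : lmodType k)
    (act : M -> A -> M) : Prop :=
  (forall m, act m 1 = m) /\ (forall m a b, act m (a * b) = act (act m a) b).

Section HopfQBrace.
Variables (k : fieldType) (H : hopfAlgType k).
Variables dot colon : {linear (H ⊗ H)%type -> H}.

Local Notation "x · y" := (dot (x ⊗ y)) (at level 40, left associativity).
Local Notation "x ∶ y" := (colon (x ⊗ y)) (at level 40, left associativity).

(* The Sweedler components are those of H, not of H^cop.                       *)
Definition qbrace_pairing (t : H ⊗ H^cop) : H^cop ⊗ H :=
  \tsum_(x, y <- t) \tsum_(x1, x2 <- comul (x : H)) \tsum_(y1, y2 <- comul (y : H))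
    (y1 ∶ x2 : H^cop) ⊗ (x1 · y2).

Lemma qbrace_pairing_linear : linear qbrace_pairing.
Proof. by rewrite /qbrace_pairing; lin. Qed.

HB.instance Definition _ :=
  GRing.isLinear.Build k (H ⊗ H^cop)%type (H^cop ⊗ H)%type *:%R
    qbrace_pairing qbrace_pairing_linear.

Definition qbrace_G (t : H ⊗ H) : H ⊗ H :=
  \tsum_(x, y <- t) \tsum_(y1, y2 <- comul y) (x · y1) ⊗ y2.

Record hopf_qbrace : Prop := {
  qb_counit_dot : forall x y, counit (x · y) = counit x * counit y :> k;
  qb_counit_colon : forall x y, counit (x ∶ y) = counit x * counit y :> k;
  qb_pairing : coalg_morphism qbrace_pairing;
  qb_bij : bijective qbrace_G;
  qb_dot_dot : forall x y z,
    \tsum_(y1, y2 <- comul y) (x · y1) · (z ∶ y2) =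
    \tsum_(z1, z2 <- comul z) (x · z2) · (y · z1);
  qb_dot_colon : forall x y z,
    \tsum_(y1, y2 <- comul y) (x · y1) ∶ (z · y2) =
    \tsum_(z1, z2 <- comul z) (x ∶ z2) · (y ∶ z1);
  qb_colon_colon : forall x y z,
    \tsum_(y1, y2 <- comul y) (x ∶ y1) ∶ (z ∶ y2) =
    \tsum_(z1, z2 <- comul z) (x ∶ z2) ∶ (y · z1);
  qb_dot_module : @right_module_action k H^c H (fun x y => x · y);
  qb_colon_module : @right_module_action k H^c H (fun x y => x ∶ y);
  qb_mul_dot : forall h m l : H,
    (h * m) · l =
    \tsum_(l1, l2 <- comul l) \tsum_(m1, m2 <- comul m)
      (h · (l1 ∶ m2)) * (m1 · l2);
  qb_mul_colon : forall h m l : H,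
    (h * m) ∶ l =
    \tsum_(l1, l2 <- comul l) \tsum_(m1, m2 <- comul m)
      (h ∶ (l1 · m2)) * (m1 ∶ l2)
}.

Definition hopf_skew_brace : Prop :=
  hopf_qbrace /\
  forall h m : H,
    \tsum_(h1, h2 <- comul h) (m ∶ h2) * h1 =
    \tsum_(m1, m2 <- comul m) (h · m1) * m2.

End HopfQBrace.

(* Main.v *)
Require Import Defs.
From HB Require Import structures.
From mathcomp Require Import all_boot all_order all_algebra.

Import GRing.Theory.
Local Open Scope ring_scope.

Set Implicit Arguments.
Unset Strict Implicit.
Unset Printing Implicit Defensive.

(** Write s(h ⊗ l) = L(h1, l1) ⊗ R(h2, l2), where L is the left action and R the
    right action read off from s.  Since R(h, lm) = R(R(h, l), m), the map G_s has
    inverse h ⊗ l |-> R(h, S l1) ⊗ l2, so h · l = R(h, S l); in other words · is the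
    convolution inverse of R in its second argument, and this is all that is ever
    used about the antipode.  By definition l ∶ x is the sum of L(x · l1, l2).

    The pivot of the proof is the identity (lemma sum_br_dot)

      s(x · y1 ⊗ y2) = (y ∶ x2) ⊗ x1,

    which computes s ∘ G_s^-1.  It follows from s being a coalgebra morphism, which
    lets the two components of s be evaluated on swapped Sweedler legs.

    Multiplying out the two tensor factors turns this identity into the theorem, up
    to the q-brace axioms: the right-hand side becomes (y ∶ x2) x1, while μ ∘ s = μ
    says that the left-hand side becomes (x · y1) y2.  As the x · y1 ⊗ y2 span
    H ⊗ H, braided commutativity and skew-brace compatibility are the same condition
    (skew_compatibleP).

    It remains to see that a braiding operator yields a Hopf q-brace.  The pivot
    gives the exchange law (y1 ∶ x2) ⊗ (x1 · y2) = (y2 ∶ x1) ⊗ (x2 · y1)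
    (colon_dot_swap), hence the comultiplication of y ∶ x and the pairing axiom; with
    the compatibility of s with μ it gives the two product formulas mul_dot and
    mul_colon, hence both module axioms.  Two of the three brace laws are then the
    module axioms applied to the skew-brace compatibility.  The mixed law dot_colon
    is obtained by undoing a right division with R, by the middle component of the
    braid equation and by the pivot used once in each direction.

    The Sweedler computations are carried out over a bare vector space carrying the
    operations and identities collected in the record braid_calculus; the tactic
    regroup settles the steps that only use coassociativity and the interchange of
    sums. *)

(** * Linearity of iterated sums over pure tensors *)

Section Multilinearity.
Variable k : fieldType.
Implicit Types U V W X : lmodType k.

Lemma bilin_linl U V W X (f : U -> V -> W) (g : X -> U) v :
  bilin f -> linear g -> linear (fun x => f (g x) v).
Proof. by move=> bf lg a x y; rewrite lg; exact: bf.1. Qed.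

Lemma bilin_linr U V W X (f : U -> V -> W) (g : X -> V) u :
  bilin f -> linear g -> linear (fun x => f u (g x)).
Proof. by move=> bf lg a x y; rewrite lg; exact: bf.2. Qed.

Lemma linear_comp U W X (f : U -> W) (g : X -> U) :
  linear f -> linear g -> linear (fun x => f (g x)).
Proof. by move=> lf lg a x y; rewrite lg lf. Qed.

Lemma tlift_linl U V W X (f : U -> V -> W) (g : X -> U ⊗ V) :
  linear g -> bilin f -> linear (fun x => tlift f (g x)).
Proof. by move=> lg bf a x y; rewrite lg tlift_linear. Qed.

Lemma linear_tsum U V W X (f : W -> X) (g : U -> V -> W) t :
  linear f -> f (tlift g t) = \tsum_(u, v <- t) f (g u v).
Proof.
move=> lf; pose F : {linear W -> X} := HB.pack f (GRing.isLinear.Build _ _ _ _ f lf).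
exact: (linear_tlift F).
Qed.

Lemma linear_scale U W (f : U -> W) (c : k) u : linear f -> f (c *: u) = c *: f u.
Proof. by move=> lf; rewrite (GRing.scalable_linear lf). Qed.

Lemma tsum_scaler U V W (c : k) (f : U -> V -> W) t :
  \tsum_(u, v <- t) (c *: f u v) = c *: tlift f t.
Proof. by rewrite -(@linear_tsum _ _ _ _ (fun w => c *: w)) //; lin. Qed.

End Multilinearity.

(** Syntax-directed proof of linearity: the head of the function decides which
    composition lemma applies, and the atomic operations are found linear or
    bilinear in the context.  A variable of a pattern may capture the bound variable
    x, hence the abstraction of every argument over x and the test that it is
    constant. *)
Ltac mlin :=
  cbv beta;
  lazymatch goal with
  | |- bilin (fun _ _ => _) => apply: lin_bilin => ?; mlin
  | |- bilin _ => first [assumption | exact: tens_bilin]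
  | |- @GRing.linear_for _ _ _ _ (fun x => x) => exact: lin_id
  | |- @GRing.linear_for _ _ _ _ (fun x => @tlift _ _ _ _ _ (@?t x)) =>
      lazymatch t with
      | (fun _ => ?c) => apply: lin_tlift_body => ? ?; mlin
      | _ => apply: tlift_linl; mlin
      end
  | |- @GRing.linear_for _ _ _ _ (fun x => @GRing.scale _ _ (@?a x) _) =>
      lazymatch a with
      | (fun _ => ?c) => apply: lin_scaler; mlin
      | _ => apply: lin_scalel; mlin
      end
  | |- @GRing.linear_for _ _ _ _ (fun x => ?op (@?a x) (@?b x)) =>
      lazymatch a with
      | (fun _ => ?c) => apply: (@bilin_linr _ _ _ _ _ op); mlin
      | _ => apply: (@bilin_linl _ _ _ _ _ op); mlin
      end
  | |- @GRing.linear_for _ _ _ _ (fun x => ?f (@?g x)) =>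
      apply: (@linear_comp _ _ _ _ f); mlin
  | |- @GRing.linear_for _ _ _ _ (?op ?b) => first [assumption |
      apply: (@bilin_linr _ _ _ _ _ op); [mlin | exact: lin_id]]
  | |- @GRing.linear_for _ _ _ _ ?f => assumption
  end.

(** * Normalizing Sweedler sums *)

Ltac under_tsum tac :=
  apply: tlift_ext;
  let a := fresh "a" in let b := fresh "b" in intros a b; cbv beta; tac a b.

(** Moves the sum over the coproduct of v in front of all others; fails if there is
    none. *)
Ltac hoist v :=
  cbv beta;
  lazymatch goal with
  | |- @tlift _ _ _ _ _ (_ v) = _ => reflexivity
  | |- @tlift _ _ _ _ _ _ = _ =>
     etransitivity; [under_tsum ltac:(fun a b => hoist v) | exact: tlift_exchange]
  end.

(** * The Sweedler calculus of a weak braiding operator *)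

Section Calculus.
Variables (k : fieldType) (H : lmodType k).
Variables (cop : H -> H ⊗ H) (eps : H -> k^o) (one : H).
Variables (mul L R D C : H -> H -> H) (br : H -> H -> H ⊗ H).

Local Notation "\sw_ ( x , y <- t ) E" := (tlift (fun x y => E) (cop t))
  (at level 41, x name, y name, t at level 99, E at level 41,
   format "\sw_ ( x ,  y  <-  t )  E") : ring_scope.

(** What a weak braiding operator br gives on H, with L and R its two actions, D the
    operation · and C the operation ∶.  The last three fields say that D is the
    convolution inverse of R and define C; bilinear operations are kept as curried
    functions so that Sweedler sums over them stay syntactically simple. *)
Record braid_calculus : Prop := {
  cop_lin : linear cop;
  eps_lin : linear eps;
  mul_bilin : bilin mul;
  L_bilin : bilin L;
  R_bilin : bilin R;
  D_bilin : bilin D;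
  C_bilin : bilin C;
  br_bilin : bilin br;
  cop_assoc : forall (W : lmodType k) (f : H -> H -> H -> W) (x : H),
    (forall b c, linear (fun a => f a b c)) ->
    (forall a c, linear (fun b => f a b c)) ->
    (forall a b, linear (f a b)) ->
    \sw_(a, b <- x) \sw_(c, d <- a) f c d b =
    \sw_(a, b <- x) \sw_(c, d <- b) f a c d;
  eps_copl : forall x, \sw_(a, b <- x) (eps a : k) *: b = x;
  eps_copr : forall x, \sw_(a, b <- x) (eps b : k) *: a = x;
  cop_one : cop one = one ⊗ one;
  eps_one : eps one = 1 :> k;
  cop_mul : forall x y, cop (mul x y) =
    \sw_(a, b <- x) \sw_(c, d <- y) mul a c ⊗ mul b d;
  eps_mul : forall x y, eps (mul x y) = eps x * eps y :> k;
  eps_L : forall x y, eps (L x y) = eps x * eps y :> k;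
  eps_R : forall x y, eps (R x y) = eps x * eps y :> k;
  cop_L : forall x y, cop (L x y) = \sw_(a, b <- x) \sw_(c, d <- y) L a c ⊗ L b d;
  cop_R : forall x y, cop (R x y) = \sw_(a, b <- x) \sw_(c, d <- y) R a c ⊗ R b d;
  br_cop : forall x y, br x y = \sw_(a, b <- x) \sw_(c, d <- y) L a c ⊗ R b d;
  br_swapped : forall x y, br x y = \sw_(a, b <- x) \sw_(c, d <- y) L b d ⊗ R a c;
  L_one : forall x, L one x = x;
  R_one : forall x, R x one = x;
  one_R : forall x, R one x = (eps x : k) *: one;
  mul_L : forall a b c, L (mul a b) c = L a (L b c);
  R_mul : forall a b c, R a (mul b c) = R (R a b) c;
  mul_R : forall a b c, R (mul a b) c = \tsum_(p, q <- br b c) mul (R a p) q;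
  L_mul : forall a b c, L a (mul b c) = \tsum_(p, q <- br a b) mul p (L q c);
  br_middle : forall a b c,
    \tsum_(p, q <- br a b) R p (L q c) = \tsum_(p, q <- br b c) L (R a p) q;
  DR_cancel : forall x y, \sw_(a, b <- y) D (R x a) b = (eps y : k) *: x;
  RD_cancel : forall x y, \sw_(a, b <- y) R (D x a) b = (eps y : k) *: x;
  colon_def : forall x y, C x y = \sw_(a, b <- x) L (D y a) b
}.

Hypothesis BC : braid_calculus.

Let bcop : linear cop. Proof. exact: cop_lin. Qed.
Let beps : linear eps. Proof. exact: eps_lin. Qed.
Let bmul : bilin mul. Proof. exact: mul_bilin. Qed.
Let bL : bilin L. Proof. exact: L_bilin. Qed.
Let bR : bilin R. Proof. exact: R_bilin. Qed.
Let bD : bilin D. Proof. exact: D_bilin. Qed.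
Let bC : bilin C. Proof. exact: C_bilin. Qed.
Let bbr : bilin br. Proof. exact: br_bilin. Qed.

(** Brings the iterated coproduct of v into the shape of a right comb standing in
    front of all other sums; two Sweedler sums with the same legs, up to
    coassociativity and the order of summation, get the same shape. *)
Ltac pull v :=
  tryif (etransitivity; [solve [hoist v] | cbv beta])
  then pull_top v else reflexivity
with pull_top v :=
  tryif (etransitivity; [under_tsum ltac:(fun a b => solve [hoist a]) | cbv beta])
  then (etransitivity; [apply: (cop_assoc BC); intros; mlin | cbv beta; pull_top v])
  else under_tsum ltac:(fun a b => pull b).

Tactic Notation "pull_both" constr(v) :=
  etransitivity; [pull v | symmetry; etransitivity; [pull v | symmetry; cbv beta]].
Tactic Notation "regroup" constr(x) := pull_both x; reflexivity.
Tactic Notation "regroup" constr(x) constr(y) := pull_both x; pull_both y; reflexivity.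

Section Identities.
Variable W : lmodType k.
Implicit Types (f : H -> W) (g : H -> H -> W).

Lemma sw_epsl f x : linear f -> \sw_(a, b <- x) (eps a : k) *: f b = f x.
Proof.
move=> lf; rewrite -[in RHS](eps_copl BC x) linear_tsum //; apply: tlift_ext => a b.
by rewrite linear_scale.
Qed.

Lemma sw_epsr f x : linear f -> \sw_(a, b <- x) (eps b : k) *: f a = f x.
Proof.
move=> lf; rewrite -[in RHS](eps_copr BC x) linear_tsum //; apply: tlift_ext => a b.
by rewrite linear_scale.
Qed.

Lemma sw_DR f x y : linear f ->
  \sw_(a, b <- y) f (D (R x a) b) = (eps y : k) *: f x.
Proof.
by move=> lf; rewrite -linear_tsum // (DR_cancel BC) linear_scale.
Qed.

Lemma sw_RD f x y : linear f ->
  \sw_(a, b <- y) f (R (D x a) b) = (eps y : k) *: f x.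
Proof.
by move=> lf; rewrite -linear_tsum // (RD_cancel BC) linear_scale.
Qed.

(** Cancellation of D against R on the first legs of an iterated coproduct, whose last
    leg may occur elsewhere. *)
Lemma sw_DRl g x y : bilin g ->
  \sw_(u, v <- y) \sw_(a, b <- u) g (D (R x a) b) v = g x y.
Proof.
move=> bg; transitivity (\sw_(u, v <- y) (eps u : k) *: g x v).
  by under_tsum ltac:(fun u v => apply: (@sw_DR (g^~ v)); mlin).
by apply: sw_epsl; mlin.
Qed.

Lemma sw_RDl g x y : bilin g ->
  \sw_(u, v <- y) \sw_(a, b <- u) g (R (D x a) b) v = g x y.
Proof.
move=> bg; transitivity (\sw_(u, v <- y) (eps u : k) *: g x v).
  by under_tsum ltac:(fun u v => apply: (@sw_RD (g^~ v)); mlin).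
by apply: sw_epsl; mlin.
Qed.

Lemma sw_R g x y : bilin g -> tlift g (cop (R x y)) =
  \sw_(a, b <- x) \sw_(c, d <- y) g (R a c) (R b d).
Proof.
move=> bg; rewrite (cop_R BC) tlift_tlift //; apply: tlift_ext => a b.
by rewrite tlift_tlift //; apply: tlift_ext => c d; rewrite tlift_tens.
Qed.

Lemma sw_L g x y : bilin g -> tlift g (cop (L x y)) =
  \sw_(a, b <- x) \sw_(c, d <- y) g (L a c) (L b d).
Proof.
move=> bg; rewrite (cop_L BC) tlift_tlift //; apply: tlift_ext => a b.
by rewrite tlift_tlift //; apply: tlift_ext => c d; rewrite tlift_tens.
Qed.

Lemma sw_mul g x y : bilin g -> tlift g (cop (mul x y)) =
  \sw_(a, b <- x) \sw_(c, d <- y) g (mul a c) (mul b d).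
Proof.
move=> bg; rewrite (cop_mul BC) tlift_tlift //; apply: tlift_ext => a b.
by rewrite tlift_tlift //; apply: tlift_ext => c d; rewrite tlift_tens.
Qed.

Lemma sum_br g x y : bilin g -> tlift g (br x y) =
  \sw_(a, b <- x) \sw_(c, d <- y) g (L a c) (R b d).
Proof.
move=> bg; rewrite (br_cop BC) tlift_tlift //; apply: tlift_ext => a b.
by rewrite tlift_tlift //; apply: tlift_ext => c d; rewrite tlift_tens.
Qed.

Lemma sum_br_swapped g x y : bilin g -> tlift g (br x y) =
  \sw_(a, b <- x) \sw_(c, d <- y) g (L b d) (R a c).
Proof.
move=> bg; rewrite (br_swapped BC) tlift_tlift //; apply: tlift_ext => a b.
by rewrite tlift_tlift //; apply: tlift_ext => c d; rewrite tlift_tens.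
Qed.

(** · is anti-comultiplicative in its second argument, being the convolution inverse
    of the comultiplicative R.  Concretely, the right-hand side G(x, y) satisfies
    G(R(x, y1), y2) = ε(y) Δ(x), and x is replaced by x · y1. *)
Lemma sw_dot g x y : bilin g -> tlift g (cop (D x y)) =
  \sw_(a, b <- x) \sw_(c, d <- y) g (D a d) (D b c).
Proof.
move=> bg; pose G u v := \sw_(a, b <- u) \sw_(c, d <- v) g (D a d) (D b c).
have bG : bilin G by rewrite /G; mlin.
have GR u v : \sw_(c, d <- v) G (R u c) d = (eps v : k) *: tlift g (cop u).
  transitivity (\sw_(a, b <- u) \sw_(c, r <- v) \sw_(m, d <- r) \sw_(p, q <- m)
      g (D (R a c) d) (D (R b p) q)).
    rewrite /G; etransitivity.
      by under_tsum ltac:(fun c d => rewrite sw_R; [reflexivity | mlin]).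
    by regroup u v.
  rewrite -tsum_scaler; apply: tlift_ext => a b.
  transitivity (\sw_(c, r <- v) g (D (R a c) r) b).
    apply: tlift_ext => c r.
    etransitivity; last by apply: (@sw_DRl (fun p q => g (D (R a c) q) p)); mlin.
    by [].
  by apply: (@sw_DR (g^~ b)); mlin.
(* Insert ε on the last leg of y and expand it by GR with u := x · y1. *)
transitivity (\sw_(c, d <- y) \sw_(d1, d2 <- d) G (R (D x c) d1) d2).
  rewrite -(@sw_epsr (fun z => tlift g (cop (D x z)))); last by mlin.
  by under_tsum ltac:(fun c d => rewrite GR).
transitivity (\sw_(u, v <- y) \sw_(a, b <- u) G (R (D x a) b) v); first by regroup y.
exact: sw_RDl.
Qed.

Lemma colon_sum f x y : linear f -> f (C y x) = \sw_(a, b <- y) f (L (D x a) b).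
Proof. by move=> lf; rewrite (colon_def BC) linear_tsum. Qed.

(** The pivot: after expanding s on swapped legs, the inner legs of y form a block
    R(x1 · y2, y3) that collapses to x1. *)
Lemma sum_br_dot g x y : bilin g ->
  \sw_(a, b <- y) tlift g (br (D x a) b) = \sw_(c, d <- x) g (C y d) c.
Proof.
move=> bg; transitivity (\sw_(c, d <- x) \sw_(u, v <- y) \sw_(m, r <- v)
    \sw_(p, q <- m) g (L (D d u) r) (R (D c p) q)).
  transitivity (\sw_(a, b <- y) \sw_(c, d <- x) \sw_(p, q <- a) \sw_(b1, b2 <- b)
      g (L (D d p) b2) (R (D c q) b1)); last by regroup x y.
  under_tsum ltac:(fun u v => rewrite sum_br_swapped // sw_dot //; last by mlin).
apply: tlift_ext => c d.
etransitivity; last by symmetry; apply: (@colon_sum (g^~ c)); mlin.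
apply: tlift_ext => u v.
by apply: (@sw_RDl (fun p q => g (L (D d u) q) p)); mlin.
Qed.

(** The pivot turns the left-hand side into a value of s; when s is evaluated on
    unswapped legs, its factor R cancels against the division by the last leg
    of y. *)
Lemma colon_dot_swap g x y : bilin g ->
  \sw_(a, b <- x) \sw_(c, d <- y) g (C c b) (D a d) =
  \sw_(a, b <- x) \sw_(c, d <- y) g (C d a) (D b c).
Proof.
move=> bg.
transitivity (\sw_(c, d <- y) \sw_(p, q <- c)
    tlift (fun u v => g u (D v d)) (br (D x p) q)).
  etransitivity; [by hoist y | apply: tlift_ext => c d].
  by symmetry; apply: sum_br_dot; mlin.
transitivity (\sw_(a, b <- x) \sw_(u, v <- y) \sw_(c, m <- u) \sw_(d, e <- m)
    \sw_(p, q <- v) g (L (D a d) e) (D (R (D b c) p) q)).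
  transitivity (\sw_(c, d <- y) \sw_(p, q <- c) \sw_(a, b <- x) \sw_(p1, p2 <- p)
      \sw_(q1, q2 <- q) g (L (D a p2) q1) (D (R (D b p1) q2) d)); last by regroup x y.
  under_tsum ltac:(fun c d => under_tsum ltac:(fun p q =>
    rewrite sum_br; [rewrite sw_dot //; mlin | mlin])).
apply: tlift_ext => a b.
transitivity (\sw_(u, v <- y) (eps v : k) *:
   \sw_(c, m <- u) \sw_(d, e <- m) g (L (D a d) e) (D b c)).
  apply: tlift_ext => u v; rewrite -tsum_scaler; apply: tlift_ext => c m.
  rewrite -tsum_scaler; apply: tlift_ext => d e.
  by apply: (@sw_DR (g (L (D a d) e))); mlin.
rewrite (@sw_epsr (fun u => \sw_(c, m <- u) \sw_(d, e <- m) g (L (D a d) e) (D b c)));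
  last by mlin.
by under_tsum ltac:(fun c m => symmetry; apply: (@colon_sum (g^~ (D b c))); mlin).
Qed.

Lemma sw_colon g x y : bilin g -> tlift g (cop (C y x)) =
  \sw_(a, b <- x) \sw_(c, d <- y) g (C c b) (C d a).
Proof.
move=> bg; rewrite (@colon_sum (fun z => tlift g (cop z))); last by mlin.
transitivity (\sw_(u, v <- y) \sw_(a, b <- x) \sw_(c, d <- u) g (C d a) (L (D b c) v)).
  transitivity (\sw_(u, v <- y) \sw_(a, b <- x) \sw_(p, q <- u) \sw_(c, d <- v)
      g (L (D a q) c) (L (D b p) d)).
    under_tsum ltac:(fun u v => rewrite sw_L // sw_dot //; mlin).
  transitivity (\sw_(u, v <- y) \sw_(a, b <- x) \sw_(c, d <- u) \sw_(p, q <- d)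
      g (L (D a p) q) (L (D b c) v)); first by regroup x y.
  under_tsum ltac:(fun u v => under_tsum ltac:(fun a b => under_tsum ltac:(fun c d =>
    symmetry; apply: (@colon_sum (g^~ (L (D b c) v))); mlin))).
transitivity (\sw_(u, v <- y) \sw_(a, b <- x) \sw_(c, d <- u) g (C c b) (L (D a d) v)).
  under_tsum ltac:(fun u v => symmetry; apply: (@colon_dot_swap (fun p q => g p (L q v))); mlin).
transitivity (\sw_(a, b <- x) \sw_(c, d <- y) \sw_(p, q <- d) g (C c b) (L (D a p) q)).
  by regroup x y.
under_tsum ltac:(fun a b => under_tsum ltac:(fun c d =>
    symmetry; apply: (@colon_sum (g (C c b))); mlin)).
Qed.

End Identities.

(** The only swap needed for the pairing to be comultiplicative is the exchange law
    on the middle legs of x and y; f, f' and g stand for the tensor products. *)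
Lemma sw_pairing (U V W : lmodType k) (f : H -> H -> U) (f' : H -> H -> V)
    (g : U -> V -> W) x y : bilin f -> bilin f' -> bilin g ->
  \sw_(a, b <- x) \sw_(c, d <- y) \tsum_(a1, a2 <- cop (C c b))
    \tsum_(b1, b2 <- cop (D a d)) g (f a2 b1) (f' a1 b2) =
  \sw_(x1, x2 <- x) \sw_(y1, y2 <- y) \sw_(a, b <- x1) \sw_(c, d <- y2)
    \sw_(a', b' <- x2) \sw_(c', d' <- y1)
      g (f (C c b) (D a d)) (f' (C c' b') (D a' d')).
Proof.
move=> bf bf' bg.
transitivity (\sw_(a, x' <- x) \sw_(x'', b <- x') \sw_(c, y' <- y) \sw_(y'', d <- y')
    \sw_(p, q <- x'') \sw_(u, v <- y'')
      g (f (C u q) (D a d)) (f' (C c b) (D p v))).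
  transitivity (\sw_(a, b <- x) \sw_(c, d <- y) \sw_(b1, b2 <- b) \sw_(c1, c2 <- c)
    \sw_(a1, a2 <- a) \sw_(d1, d2 <- d)
      g (f (C c2 b1) (D a1 d2)) (f' (C c1 b2) (D a2 d1))); last by regroup x y.
  do 2!apply: tlift_ext => ? ?; rewrite sw_colon; last by mlin.
  by do 2!apply: tlift_ext => ? ?; rewrite sw_dot //; mlin.
transitivity (\sw_(a, x' <- x) \sw_(x'', b <- x') \sw_(c, y' <- y) \sw_(y'', d <- y')
    \sw_(p, q <- x'') \sw_(u, v <- y'')
      g (f (C v p) (D a d)) (f' (C c b) (D q u))); last by regroup x y.
do 4!apply: tlift_ext => ? ?.
by apply: (@colon_dot_swap _ (fun m n => g (f m _) (f' _ n))); mlin.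
Qed.

Lemma eps_dot x y : eps (D x y) = eps x * eps y :> k.
Proof.
have e : \sw_(a, b <- y) eps (R (D x a) b) = (eps y : k) *: eps x by apply: sw_RD.
rewrite [RHS]mulrC; apply: etrans e.
rewrite -(@sw_epsr _ (fun z => eps (D x z))); last by mlin.
by apply: eq_bigr => p _; rewrite (eps_R BC) mulrC.
Qed.

Lemma eps_colon y x : eps (C y x) = eps y * eps x :> k.
Proof.
rewrite colon_sum //.
transitivity (\sw_(a, b <- y) (eps x : k) *: ((eps a : k) *: eps b)).
  by apply: eq_bigr => p _; rewrite (eps_L BC) eps_dot; exact: esym (mulrA _ _ _).
by rewrite tsum_scaler sw_epsl // [RHS]mulrC.
Qed.

Lemma dot_one x : D x one = x.
Proof.
have := DR_cancel BC x one; rewrite (cop_one BC) tlift_tens; last by mlin.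
by rewrite (R_one BC) (eps_one BC) scale1r.
Qed.

Lemma one_dot x : D one x = (eps x : k) *: one.
Proof.
rewrite -(DR_cancel BC one x); rewrite -{1}(eps_copl BC x) (linear_tsum (f := D one)); last by mlin.
apply: tlift_ext => a b; rewrite (one_R BC) (bilinZl _ _ _ bD).
by rewrite (linear_scale _ _ (bD.2 one)).
Qed.

Lemma colon_one x : C x one = x.
Proof.
rewrite (colon_def BC); transitivity (\sw_(a, b <- x) (eps a : k) *: b).
  by apply: tlift_ext => a b; rewrite one_dot (bilinZl _ _ _ bL) (L_one BC).
exact: eps_copl.
Qed.

(** Uniqueness of convolution inverses: the way to identify an expression in z with
    x · z is to apply R to it. *)
Lemma dot_unique (F : H -> H) x y : linear F ->
  (forall z, \sw_(a, b <- z) R (F a) b = (eps z : k) *: x) -> F y = D x y.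
Proof.
move=> lF e; rewrite -(@sw_epsr _ F) //.
transitivity (\sw_(a, b <- y) \sw_(c, d <- b) D (R (F a) c) d).
  by apply: tlift_ext => a b; rewrite (DR_cancel BC).
transitivity (\sw_(u, v <- y) \sw_(a, b <- u) D (R (F a) b) v); first by regroup y.
transitivity (\sw_(u, v <- y) (eps u : k) *: D x v).
  apply: tlift_ext => u v; rewrite -(linear_tsum (f := D^~ v)); last by mlin.
  by rewrite e (bilinZl _ _ _ bD).
by apply: sw_epsl; mlin.
Qed.

(** Both sides are convolution inverse to R(x, l m), because R is a right action. *)
Lemma dot_mul x l m : D x (mul l m) = D (D x m) l.
Proof.
transitivity (\sw_(a, b <- l) \sw_(c, d <- m) (eps (mul b d) : k) *: D (D x c) a).
  transitivity (\sw_(a, b <- l) \sw_(c, d <- m) \tsum_(p, q <- cop (mul b d))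
      D (R (D (D x c) a) p) q); last first.
    by do 2!apply: tlift_ext => ? ?; rewrite (DR_cancel BC).
  transitivity (\sw_(a, b <- l) \sw_(c, d <- m) \sw_(l1, l2 <- a) \sw_(m1, m2 <- c)
      D (R (R (D (D x m1) l1) l2) m2) (mul b d)); last first.
    etransitivity; last first.
      by under_tsum ltac:(fun a b => under_tsum ltac:(fun c d =>
         symmetry; apply: sw_mul; mlin)).
    transitivity (\sw_(a, b <- l) \sw_(c, d <- m) \sw_(l1, l2 <- b) \sw_(m1, m2 <- d)
      D (R (R (D (D x c) a) l1) m1) (mul l2 m2)); first by regroup l m.
    by do 4!apply: tlift_ext => ? ?; rewrite (R_mul BC).
  transitivity (\sw_(a, b <- l) \sw_(c, d <- m) (eps (mul a c) : k) *: D x (mul b d)).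
    transitivity (\sw_(a, b <- l) (eps a : k) *: \sw_(c, d <- m) (eps c : k) *: D x (mul b d)).
      by symmetry; rewrite sw_epsl; [rewrite sw_epsl //|]; mlin.
    apply: tlift_ext => a b; rewrite -tsum_scaler; apply: tlift_ext => c d.
    by rewrite (eps_mul BC) scalerA.
  apply: tlift_ext => a b; apply: tlift_ext => c d.
  rewrite (eps_mul BC) tlift_exchange.
  transitivity (\sw_(m1, m2 <- c) (eps a : k) *: D (R (D x m1) m2) (mul b d)).
    rewrite tsum_scaler (@sw_RD _ (D^~ (mul b d))) ?scalerA //; mlin.
  apply: tlift_ext => m1 m2; symmetry.
  by apply: (@sw_RD _ (fun z => D (R z m2) (mul b d))); mlin.
transitivity (\sw_(a, b <- l) (eps b : k) *: \sw_(c, d <- m) (eps d : k) *: D (D x c) a).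
  apply: tlift_ext => a b; rewrite -tsum_scaler; apply: tlift_ext => c d.
  by rewrite (eps_mul BC) scalerA.
by rewrite sw_epsr; [rewrite (@sw_epsr _ (fun z => D (D x z) l)) //|]; mlin.
Qed.

(** Apply R to the right-hand side.  The product rule for R produces s(m1 · l2 ⊗ l3),
    which the pivot turns into l2 ∶ m2 and a bare m1; then R(h · (l1 ∶ m3), l2 ∶ m2)
    has the coproduct of l ∶ m as legs and cancels. *)
Lemma mul_dot h m l : D (mul h m) l =
  \sw_(a, b <- l) \sw_(c, d <- m) mul (D h (C a d)) (D c b).
Proof.
symmetry; apply: (@dot_unique (fun l =>
  \sw_(a, b <- l) \sw_(c, d <- m) mul (D h (C a d)) (D c b))) => [|z]; first by mlin.
transitivity (\sw_(a, b <- z) \sw_(c, d <- m) \sw_(u, v <- b)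
   \tsum_(p, q <- br (D c u) v) mul (R (D h (C a d)) p) q).
  transitivity (\sw_(a, b <- z) \sw_(u, v <- a) \sw_(c, d <- m)
     R (mul (D h (C u d)) (D c v)) b).
    apply: tlift_ext => a b; rewrite (linear_tsum (f := R^~ b)); last by mlin.
    by apply: tlift_ext => u v; rewrite (linear_tsum (f := R^~ b)) //; mlin.
  transitivity (\sw_(a, b <- z) \sw_(u, v <- a) \sw_(c, d <- m)
     \tsum_(p, q <- br (D c v) b) mul (R (D h (C u d)) p) q).
    by do 3!apply: tlift_ext => ? ?; rewrite (mul_R BC).
  by regroup z m.
transitivity (\sw_(a, b <- z) \sw_(c, d <- m) \sw_(p, q <- c)
   mul (R (D h (C a d)) (C b q)) p).
  do 2!apply: tlift_ext => ? ?.
  by apply: (@sum_br_dot _ (fun p q => mul (R _ p) q)); mlin.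
transitivity (\sw_(p, r <- m) \sw_(a, b <- z) \sw_(q, d <- r)
   mul (R (D h (C a d)) (C b q)) p); first by regroup z m.
transitivity (\sw_(p, r <- m) (eps r : k) *: ((eps z : k) *: mul h p)); last first.
  by rewrite (@sw_epsr _ (fun p => (eps z : k) *: mul h p)) //; mlin.
apply: tlift_ext => p r.
transitivity (\tsum_(u, v <- cop (C z r)) mul (R (D h u) v) p).
  rewrite sw_colon; last by mlin.
  by regroup z r.
rewrite (@sw_RD _ (mul^~ p)); last by mlin.
by rewrite scalerA eps_colon; congr (_ *: _); exact: mulrC.
Qed.

(** The left action of (l · m) · h on a product is read through s((l · m) · h1 ⊗ h2),
    where the pivot applies; the exchange law reorders the outcome. *)
Lemma mul_colon h m l : C (mul h m) l =
  \sw_(a, b <- l) \sw_(c, d <- m) mul (C h (D a d)) (C c b).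
Proof.
transitivity (\sw_(u, v <- m) \sw_(a, b <- h)
    \tsum_(p, q <- br (D (D l u) a) b) mul p (L q v)).
  transitivity (\sw_(a, b <- h) \sw_(c, d <- m) L (D l (mul a c)) (mul b d)).
    by rewrite (colon_def BC) sw_mul //; mlin.
  transitivity (\sw_(a, b <- h) \sw_(c, d <- m)
     \tsum_(p, q <- br (D (D l c) a) b) mul p (L q d)); last by regroup h m.
  by do 2!apply: tlift_ext => ? ?; rewrite dot_mul (L_mul BC).
transitivity (\sw_(u, v <- m) \tsum_(a, b <- cop (D l u)) mul (C h b) (L a v)).
  apply: tlift_ext => u v.
  by apply: (@sum_br_dot _ (fun p q => mul p (L q v))); mlin.
transitivity (\sw_(u, v <- m) \sw_(a, b <- l) \sw_(c, d <- u)
    mul (C h (D b c)) (L (D a d) v)).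
  by apply: tlift_ext => u v; rewrite sw_dot //; mlin.
transitivity (\sw_(a, b <- l) \sw_(c, d <- m) mul (C h (D b c)) (C d a)).
  transitivity (\sw_(a, b <- l) \sw_(c, d <- m) \sw_(p, q <- d)
    mul (C h (D b c)) (L (D a p) q)); first by regroup m l.
  do 2!apply: tlift_ext => ? ?.
  by symmetry; apply: colon_sum; mlin.
by symmetry; apply: (@colon_dot_swap _ (fun p q => mul (C h q) p)); mlin.
Qed.

(** mul_dot splits m l · h so that L acts twice, the outer one through the coproduct
    of h ∶ l. *)
Lemma colon_mul h l m : C h (mul m l) = C (C h l) m.
Proof.
transitivity (\sw_(u, v <- h) \sw_(a, b <- l) \sw_(c, d <- u)
    L (D m (C c b)) (L (D a d) v)).
  rewrite (colon_def BC).
  apply: tlift_ext => u v; rewrite mul_dot (linear_tsum (f := L^~ v)); last by mlin.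
  rewrite [RHS]tlift_exchange; apply: tlift_ext => c d.
  rewrite (linear_tsum (f := L^~ v)); last by mlin.
  by apply: tlift_ext => a b; rewrite (mul_L BC).
transitivity (\sw_(a, b <- l) \sw_(c, d <- h) \sw_(p, q <- d)
    L (D m (C c b)) (L (D a p) q)); first by regroup h l.
rewrite [RHS](colon_def BC) sw_colon; last by mlin.
do 2!apply: tlift_ext => ? ?.
by symmetry; apply: (@colon_sum _ (L _)); mlin.
Qed.

(** * Braided commutativity and the brace laws *)

Definition skew_compatible : Prop := forall x y,
  \sw_(a, b <- x) mul (C y b) a = \sw_(a, b <- y) mul (D x a) b.

(** μ applied to the pivot; for the converse, x ⊗ y is the sum of the
    R(x, y1) · y2 ⊗ y3. *)
Lemma skew_compatibleP :
  (forall x y, tlift mul (br x y) = mul x y) <-> skew_compatible.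
Proof.
split=> [comm x y|skew x y].
  rewrite -sum_br_dot //; apply: tlift_ext => a b; exact: comm.
transitivity (\sw_(u, v <- y) \sw_(a, b <- u) tlift mul (br (D (R x a) b) v)).
  by symmetry; apply: (@sw_DRl _ (fun p q => tlift mul (br p q))); mlin.
transitivity (\sw_(u, v <- y) \sw_(a, b <- u) mul (D (R x a) b) v).
  transitivity (\sw_(u, v <- y) \sw_(a, b <- v) tlift mul (br (D (R x u) a) b)).
    by regroup y.
  transitivity (\sw_(u, v <- y) \sw_(a, b <- v) mul (D (R x u) a) b).
    by apply: tlift_ext => u v; rewrite sum_br_dot.
  by regroup y.
exact: sw_DRl.
Qed.

Section Skew.
Hypothesis skew : skew_compatible.

(** Both sides divide x by the two expressions that the skew condition equates. *)
Lemma dot_dot x y z :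
  \sw_(a, b <- y) D (D x a) (C z b) = \sw_(a, b <- z) D (D x b) (D y a).
Proof.
transitivity (D x (\sw_(a, b <- y) mul (C z b) a)).
  rewrite (linear_tsum (f := D x)); last by mlin.
  by apply: tlift_ext => a b; rewrite dot_mul.
rewrite skew (linear_tsum (f := D x)); last by mlin.
by apply: tlift_ext => a b; rewrite dot_mul.
Qed.

Lemma colon_colon x y z :
  \sw_(a, b <- y) C (C x a) (C z b) = \sw_(a, b <- z) C (C x b) (D y a).
Proof.
transitivity (C x (\sw_(a, b <- y) mul (C z b) a)).
  rewrite (linear_tsum (f := C x)); last by mlin.
  by apply: tlift_ext => a b; rewrite colon_mul.
rewrite skew (linear_tsum (f := C x)); last by mlin.
by apply: tlift_ext => a b; rewrite colon_mul.
Qed.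

(** The mixed brace law with its right-hand division by y ∶ z moved to the left.  The
    pivot, read backwards at (z · y, x · y), introduces s; the middle component of
    the braid equation then moves s to the pair (x · y1, y4), where the pivot
    removes it again once dot_dot and the exchange law have put the legs of y next
    to each other. *)
Lemma R_dot_colon x y z :
  \sw_(a, b <- z) \sw_(c, d <- y) R (\sw_(p, q <- c) C (D x p) (D b q)) (C d a) =
  (eps y : k) *: C x z.
Proof.
(* Unfolding ∶ in y2 ∶ z1 shows that the whole coproduct of z · y2 occurs. *)
transitivity (\sw_(u, v <- y) \sw_(p, q <- u)
    \tsum_(w1, w2 <- cop (D z q)) R (C (D x p) w2) (L w1 v)).
  transitivity (\sw_(p, r <- y) \sw_(a, b <- z) \sw_(c, d <- r)
      R (C (D x p) (D b c)) (C d a)).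
    transitivity (\sw_(a, b <- z) \sw_(c, d <- y) \sw_(p, q <- c)
      R (C (D x p) (D b q)) (C d a)); last by regroup z y.
    apply: tlift_ext => a b; apply: tlift_ext => c d.
    by rewrite (linear_tsum (f := R^~ (C d a))) //; mlin.
  transitivity (\sw_(p, r <- y) \sw_(a, b <- z) \sw_(c, d <- r) \sw_(m, n <- d)
      R (C (D x p) (D b c)) (L (D a m) n)).
    do 3!apply: tlift_ext => ? ?.
    by apply: (@colon_sum _ (R _)); mlin.
  transitivity (\sw_(u, v <- y) \sw_(p, q <- u) \sw_(a, b <- z) \sw_(c, d <- q)
      R (C (D x p) (D b c)) (L (D a d) v)); first by regroup y z.
  apply: tlift_ext => u v; apply: tlift_ext => p q; symmetry.
  by apply: (@sw_dot _ (fun w1 w2 => R (C (D x p) w2) (L w1 v))); mlin.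
(* The pivot at x · p and z · q, then the middle component of the braid equation. *)
transitivity (\sw_(u, v <- y) \sw_(p, q <- u) \tsum_(v1, v2 <- cop (D x p))
    \tsum_(a, b <- br v2 v) L (R (D (D z q) v1) a) b).
  apply: tlift_ext => u v; apply: tlift_ext => p q.
  transitivity (\tsum_(v1, v2 <- cop (D x p)) \tsum_(a, b <- br (D (D z q) v1) v2)
      R a (L b v)); last first.
    by apply: tlift_ext => v1 v2; rewrite (br_middle BC).
  by symmetry; apply: (@sum_br_dot _ (fun a b => R a (L b v))); mlin.
(* dot_dot applied to (z · y3) · (x1 · y2). *)
transitivity (\sw_(a, b <- x) \sw_(u, v <- y) \sw_(c, d <- u)
    \tsum_(p, q <- br (D b c) v) \sw_(e, f <- a) L (R (D (D z e) (C d f)) p) q).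
  transitivity (\sw_(a, b <- x) \sw_(u, v <- y) \sw_(c, d <- u)
      \tsum_(p, q <- br (D b c) v) \sw_(n, m <- d) L (R (D (D z m) (D a n)) p) q).
    transitivity (\sw_(u, v <- y) \sw_(c, d <- u) \sw_(a, b <- x) \sw_(m, n <- c)
        \tsum_(p, q <- br (D b m) v) L (R (D (D z d) (D a n)) p) q).
      by do 2!apply: tlift_ext => ? ?; rewrite sw_dot //; mlin.
    by regroup y x.
  apply: tlift_ext => a b; apply: tlift_ext => u v; apply: tlift_ext => c d.
  apply: tlift_ext => p q.
  rewrite -(linear_tsum (f := fun w => L (R w p) q)); last by mlin.
  by rewrite -dot_dot (linear_tsum (f := fun w => L (R w p) q)) //; mlin.
(* The exchange law makes the division inside s use the leg of y next to v, as the
   pivot requires. *)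
transitivity (\sw_(e, r <- x) \sw_(u, v <- y) \sw_(a, b <- r) \sw_(c, d <- u)
    \tsum_(p, q <- br (D a d) v) L (R (D (D z e) (C c b)) p) q).
  transitivity (\sw_(e, r <- x) \sw_(u, v <- y) \sw_(a, b <- r) \sw_(c, d <- u)
      \tsum_(p, q <- br (D b c) v) L (R (D (D z e) (C d a)) p) q).
    by regroup x y.
  apply: tlift_ext => e r; apply: tlift_ext => u v; symmetry.
  apply: (@colon_dot_swap _ (fun X Y => \tsum_(p, q <- br Y v) L (R (D (D z e) X) p) q)).
  by mlin.
(* After the pivot the two values of ∶ are the legs of a coproduct of y ∶ r'. *)
transitivity (\sw_(e, r <- x) \sw_(a, r' <- r) \tsum_(w1, w2 <- cop (C y r'))
    L (R (D (D z e) w1) w2) a).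
  transitivity (\sw_(e, r <- x) \sw_(a, b <- r) \sw_(c, w <- y) \sw_(a1, a2 <- a)
      L (R (D (D z e) (C c b)) (C w a2)) a1).
    transitivity (\sw_(e, r <- x) \sw_(a, b <- r) \sw_(c, w <- y) \sw_(d, v <- w)
        \tsum_(p, q <- br (D a d) v) L (R (D (D z e) (C c b)) p) q).
      by regroup x y.
    do 3!apply: tlift_ext => ? ?.
    by apply: (@sum_br_dot _ (fun p q => L (R _ p) q)); mlin.
  transitivity (\sw_(e, r <- x) \sw_(a, r' <- r) \sw_(a2, b <- r') \sw_(c, w <- y)
      L (R (D (D z e) (C c b)) (C w a2)) a); first by regroup x y.
  by do 2!apply: tlift_ext => ? ?; rewrite sw_colon //; mlin.
rewrite (colon_def BC) -tsum_scaler; apply: tlift_ext => e r.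
transitivity (\sw_(a, r' <- r) (eps r' : k) *: ((eps y : k) *: L (D z e) a)).
  apply: tlift_ext => a r'; rewrite (@sw_RD _ (L^~ a)); last by mlin.
  by rewrite eps_colon scalerA mulrC.
by apply: (@sw_epsr _ (fun a => (eps y : k) *: L (D z e) a)); mlin.
Qed.

Lemma dot_colon x y z :
  \sw_(a, b <- y) C (D x a) (D z b) = \sw_(a, b <- z) D (C x b) (C y a).
Proof.
pose A v w := \sw_(p, q <- v) C (D x p) (D w q).
have bA : bilin A by rewrite /A; mlin.
transitivity (\sw_(u, v <- y) (eps v : k) *: \sw_(a, b <- z) (eps a : k) *: A u b).
  by rewrite sw_epsr; [rewrite sw_epsl //|]; mlin.
transitivity (\sw_(u, v <- y) \sw_(a, b <- z) \tsum_(w1, w2 <- cop (C v a))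
    D (R (A u b) w1) w2).
  apply: tlift_ext => u v; rewrite -tsum_scaler; apply: tlift_ext => a b.
  by rewrite (DR_cancel BC) eps_colon scalerA.
transitivity (\sw_(u, v <- y) \sw_(a, b <- z) D (\sw_(c, d <- b) \sw_(m, n <- u)
     R (A m d) (C n c)) (C v a)).
  transitivity (\sw_(u, v <- y) \sw_(a, b <- z) \sw_(c, d <- b) \sw_(m, n <- u)
     D (R (A m d) (C n c)) (C v a)).
    transitivity (\sw_(u, v <- y) \sw_(a, b <- z) \sw_(c, d <- a) \sw_(m, n <- v)
       D (R (A u b) (C m d)) (C n c)); last by regroup y z.
    by do 2!apply: tlift_ext => ? ?; rewrite sw_colon //; mlin.
  apply: tlift_ext => u v; apply: tlift_ext => a b; symmetry.
  rewrite (linear_tsum (f := D^~ (C v a))); last by mlin.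
  apply: tlift_ext => c d.
  by rewrite (linear_tsum (f := D^~ (C v a))) //; mlin.
transitivity (\sw_(u, v <- y) (eps u : k) *: \sw_(a, b <- z) D (C x b) (C v a)).
  apply: tlift_ext => u v; rewrite -tsum_scaler; apply: tlift_ext => a b.
  by rewrite R_dot_colon (bilinZl _ _ _ bD).
by apply: (@sw_epsl _ (fun v => \sw_(a, b <- z) D (C x b) (C v a))); mlin.
Qed.

End Skew.

End Calculus.

(** * Coalgebra maps into a tensor product of coalgebras *)

Section Projections.
Variables (k : fieldType) (C D : coalgType k).

Definition tproj1 (t : C ⊗ D) : C := \tsum_(x, y <- t) (counit y : k) *: x.
Definition tproj2 (t : C ⊗ D) : D := \tsum_(x, y <- t) (counit x : k) *: y.

Lemma tproj1_linear : linear tproj1. Proof. by rewrite /tproj1; lin. Qed.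
Lemma tproj2_linear : linear tproj2. Proof. by rewrite /tproj2; lin. Qed.
HB.instance Definition _ := GRing.isLinear.Build k _ _ _ tproj1 tproj1_linear.
HB.instance Definition _ := GRing.isLinear.Build k _ _ _ tproj2 tproj2_linear.

Lemma tproj1_tens x y : tproj1 (x ⊗ y) = (counit y : k) *: x.
Proof. by rewrite /tproj1 tlift_tens //; lin. Qed.

Lemma tproj2_tens x y : tproj2 (x ⊗ y) = (counit x : k) *: y.
Proof. by rewrite /tproj2 tlift_tens //; lin. Qed.

Lemma tsum_comul_tens (W : lmodType k) (f : C ⊗ D -> C ⊗ D -> W) x y : bilin f ->
  tlift f (comul (x ⊗ y)) =
  \tsum_(a, b <- comul x) \tsum_(c, d <- comul y) f (a ⊗ c) (b ⊗ d).
Proof.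
move=> bf; rewrite [comul (x ⊗ y)]tens_comulE tlift_tlift //.
apply: tlift_ext => a b; rewrite tlift_tlift //.
by apply: tlift_ext => c d; rewrite tlift_tens.
Qed.

Lemma tproj12_comul t : \tsum_(p, q <- comul t) tproj1 p ⊗ tproj2 q = t.
Proof.
move: t; apply: tensor_lin_ext => [||x y]; [by lin | by lin |].
rewrite tsum_comul_tens; last by lin.
rewrite -[in RHS](counitr x) -[in RHS](counitl y) tens_tlift.
rewrite tlift_exchange [RHS]tlift_exchange.
apply: tlift_ext => a b; apply: tlift_ext => c d.
by rewrite tproj1_tens tproj2_tens !tensZ mulrC.
Qed.

(** A tensor is also recovered from its two projections taken in the opposite order;
    this is the source of every exchange of legs below. *)
Lemma tproj21_comul t : \tsum_(p, q <- comul t) tproj1 q ⊗ tproj2 p = t.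
Proof.
move: t; apply: tensor_lin_ext => [||x y]; [by lin | by lin |].
rewrite tsum_comul_tens; last by lin.
rewrite -[in RHS](counitl x) -[in RHS](counitr y) tens_tlift.
apply: tlift_ext => a b; apply: tlift_ext => c d.
by rewrite tproj1_tens tproj2_tens !tensZ mulrC.
Qed.

Lemma comul_tproj1 t : comul (tproj1 t) = \tsum_(p, q <- comul t) tproj1 p ⊗ tproj1 q.
Proof.
move: t; apply: tensor_lin_ext => [||x y]; [by lin | by lin |].
rewrite tsum_comul_tens; last by lin.
rewrite tproj1_tens linearZ /= -[X in _ *: X](tlift_id (comul x)) -tsum_scaler.
apply: tlift_ext => a b.
rewrite -[in LHS](counitl y) (linear_tsum (f := fun z => (counit z : k) *: (a ⊗ b))).
  apply: tlift_ext => c d.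
  by rewrite tproj1_tens !tproj1_tens tensZ linearZ.
by lin.
Qed.

Lemma comul_tproj2 t : comul (tproj2 t) = \tsum_(p, q <- comul t) tproj2 p ⊗ tproj2 q.
Proof.
move: t; apply: tensor_lin_ext => [||x y]; [by lin | by lin |].
rewrite tsum_comul_tens; last by lin.
rewrite tproj2_tens linearZ /= -[X in _ *: X](tlift_id (comul y)) -tsum_scaler.
rewrite tlift_exchange; apply: tlift_ext => c d.
rewrite -[in LHS](counitl x) (linear_tsum (f := fun z => (counit z : k) *: (c ⊗ d))).
  apply: tlift_ext => a b.
  by rewrite !tproj2_tens tensZ linearZ.
by lin.
Qed.

Lemma counit_tproj1 t : counit (tproj1 t) = counit t.
Proof.
move: t; apply: tensor_lin_ext => [||x y]; [by lin | by lin |].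
by rewrite tproj1_tens linearZ [RHS]tens_counitE /= mulrC.
Qed.

Lemma counit_tproj2 t : counit (tproj2 t) = counit t.
Proof.
move: t; apply: tensor_lin_ext => [||x y]; [by lin | by lin |].
by rewrite tproj2_tens linearZ [RHS]tens_counitE.
Qed.

End Projections.

(** * The calculus holds for a weak braiding operator *)

Section BraidingActions.
Variables (k : fieldType) (H : hopfAlgType k).
Variable s : {linear (H ⊗ H)%type -> (H ⊗ H)%type}.
Hypothesis ws : weak_braiding_operator s.

Lemma lactE h l : lact s h l = tproj1 (s (h ⊗ l)). Proof. by []. Qed.
Lemma ractE h l : ract s h l = tproj2 (s (h ⊗ l)). Proof. by []. Qed.

Lemma lact_bilin : bilin (lact s). Proof. by rewrite /lact; lin. Qed.
Lemma ract_bilin : bilin (ract s). Proof. by rewrite /ract; lin. Qed.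

Lemma tsum_comul_braid (W : lmodType k) (f : H ⊗ H -> H ⊗ H -> W) h l : bilin f ->
  tlift f (comul (s (h ⊗ l))) =
  \tsum_(a, b <- comul h) \tsum_(c, d <- comul l) f (s (a ⊗ c)) (s (b ⊗ d)).
Proof.
move=> bf; rewrite (wb_coalg ws).1 /tmap tlift_tlift //.
rewrite tsum_comul_tens.
  by apply: tlift_ext => a b; apply: tlift_ext => c d; rewrite tlift_tens.
by apply: lin_bilin => p; apply: tlift_linl => //; lin.
Qed.

Lemma braid_comul h l : s (h ⊗ l) =
  \tsum_(a, b <- comul h) \tsum_(c, d <- comul l) lact s a c ⊗ ract s b d.
Proof. by rewrite -[LHS]tproj12_comul tsum_comul_braid //; lin. Qed.

Lemma braid_comul_swapped h l : s (h ⊗ l) =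
  \tsum_(a, b <- comul h) \tsum_(c, d <- comul l) lact s b d ⊗ ract s a c.
Proof. by rewrite -[LHS]tproj21_comul tsum_comul_braid //; lin. Qed.

Lemma comul_lact h l : comul (lact s h l) =
  \tsum_(a, b <- comul h) \tsum_(c, d <- comul l) lact s a c ⊗ lact s b d.
Proof. by rewrite lactE comul_tproj1 tsum_comul_braid //; lin. Qed.

Lemma comul_ract h l : comul (ract s h l) =
  \tsum_(a, b <- comul h) \tsum_(c, d <- comul l) ract s a c ⊗ ract s b d.
Proof. by rewrite ractE comul_tproj2 tsum_comul_braid //; lin. Qed.

Lemma counit_lact h l : counit (lact s h l) = counit h * counit l :> k.
Proof. by rewrite lactE counit_tproj1 (wb_coalg ws).2 [LHS]tens_counitE. Qed.

Lemma counit_ract h l : counit (ract s h l) = counit h * counit l :> k.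
Proof. by rewrite ractE counit_tproj2 (wb_coalg ws).2 [LHS]tens_counitE. Qed.

Lemma lact_one l : lact s 1 l = l.
Proof. by rewrite lactE (wb_unitl ws) tproj1_tens counit1 scale1r. Qed.

Lemma ract_one h : ract s h 1 = h.
Proof. by rewrite ractE (wb_unitr ws) tproj2_tens counit1 scale1r. Qed.

Lemma one_ract l : ract s 1 l = (counit l : k) *: 1.
Proof. by rewrite ractE (wb_unitl ws) tproj2_tens. Qed.

Lemma braid12_tens (t : H ⊗ H) c : braid12 s (t ⊗ c) = s t ⊗ c.
Proof. by rewrite /braid12 tmap_tens. Qed.

Lemma braid23_tens a b c :
  braid23 s (a ⊗ b ⊗ c) = \tsum_(p, q <- s (b ⊗ c)) a ⊗ p ⊗ q.
Proof.
rewrite /braid23 /= tassoc_tens tlift_tens; last by lin.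
by rewrite tmap_tens /tassocV tlift_tens //; lin.
Qed.

Lemma tmul_tens (x y : H) : tmul (x ⊗ y) = x * y.
Proof. by rewrite /tmul tlift_tens //; lin. Qed.

Lemma braid_mull a b c : s ((a * b) ⊗ c) =
  \tsum_(p, q <- s (b ⊗ c)) \tsum_(u, v <- s (a ⊗ p)) u ⊗ (v * q).
Proof.
have := wb_mull ws (a ⊗ b ⊗ c); rewrite tmap_tens /= tmul_tens => ->.
rewrite braid23_tens.
rewrite (linear_tsum (f := fun t => tmap idfun (@tmul k H) (tassoc (braid12 s t))));
  last by rewrite /braid12; lin.
apply: tlift_ext => p q; rewrite braid12_tens tassoc_tens linear_tlift.
by apply: tlift_ext => u v; rewrite /= tmap_tens /= tmul_tens.
Qed.

Lemma braid_mulr a b c : s (a ⊗ (b * c)) =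
  \tsum_(p, q <- s (a ⊗ b)) \tsum_(u, v <- s (q ⊗ c)) (p * u) ⊗ v.
Proof.
have := wb_mulr ws (a ⊗ b ⊗ c); rewrite tassoc_tens tlift_tens; last by lin.
rewrite tmap_tens /= tmul_tens => ->; rewrite braid12_tens.
rewrite -{1}(tlift_id (s (a ⊗ b))).
rewrite (linear_tsum (f := fun t => tmap (@tmul k H) idfun (braid23 s (t ⊗ c))));
  last by rewrite /braid23; lin.
apply: tlift_ext => p q; rewrite braid23_tens linear_tlift.
by apply: tlift_ext => u v; rewrite /= tmap_tens /= tmul_tens.
Qed.

Lemma mul_lact a b c : lact s (a * b) c = lact s a (lact s b c).
Proof.
rewrite lactE braid_mull linear_tlift [lact s b c]/lact.
rewrite (linear_tsum (f := lact s a)); last by rewrite /lact; lin.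
apply: tlift_ext => p q; rewrite linear_tlift.
rewrite (linear_scale _ _ (lact_bilin.2 a)) /lact -tsum_scaler.
by apply: tlift_ext => u v; rewrite /= tproj1_tens counitM scalerA mulrC.
Qed.

Lemma ract_mul a b c : ract s a (b * c) = ract s (ract s a b) c.
Proof.
rewrite ractE braid_mulr linear_tlift [ract s a b]/ract.
rewrite (linear_tsum (f := fun x => ract s x c)); last by rewrite /ract; lin.
apply: tlift_ext => p q; rewrite linear_tlift.
rewrite (linear_scale _ _ (ract_bilin.1 c)) /ract -tsum_scaler.
by apply: tlift_ext => u v; rewrite /= tproj2_tens counitM scalerA.
Qed.

Lemma mul_ract a b c :
  ract s (a * b) c = \tsum_(p, q <- s (b ⊗ c)) ract s a p * q.
Proof.
rewrite ractE braid_mull linear_tlift; apply: tlift_ext => p q.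
rewrite linear_tlift /ract (linear_tsum (f := fun x : H => x * q)); last by lin.
by apply: tlift_ext => u v; rewrite /= tproj2_tens scalerAl.
Qed.

Lemma lact_mul a b c :
  lact s a (b * c) = \tsum_(p, q <- s (a ⊗ b)) p * lact s q c.
Proof.
rewrite lactE braid_mulr linear_tlift; apply: tlift_ext => p q.
rewrite linear_tlift /lact (linear_tsum (f := fun x : H => p * x)); last by lin.
by apply: tlift_ext => u v; rewrite /= tproj1_tens scalerAr.
Qed.

(** The braid equation with the counit applied to the two outer factors. *)
Lemma braid_middle a b c :
  \tsum_(p, q <- s (a ⊗ b)) ract s p (lact s q c) =
  \tsum_(p, q <- s (b ⊗ c)) lact s (ract s a p) q.
Proof.
pose mid (t : H ⊗ H ⊗ H) := tproj2 (tproj1 t).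
have mid_lin : linear mid by rewrite /mid; lin.
have braid12_lin : linear (braid12 s) by rewrite /braid12; lin.
have braid23_lin : linear (braid23 s) by rewrite /braid23; lin.
have mid12 p q r : mid (braid12 s (p ⊗ q ⊗ r)) = (counit r : k) *: ract s p q.
  by rewrite braid12_tens /mid tproj1_tens linearZ.
have mid23 p q r : mid (braid23 s (p ⊗ q ⊗ r)) = (counit p : k) *: lact s q r.
  rewrite braid23_tens (linear_tsum (f := mid)) // /lact -tsum_scaler.
  apply: tlift_ext => u v; rewrite /mid tproj1_tens linearZ /= tproj2_tens.
  by rewrite !scalerA mulrC.
have := congr1 mid (wb_braid ws (a ⊗ b ⊗ c)).
rewrite braid12_tens braid23_tens -{1}(tlift_id (s (a ⊗ b))).
rewrite (linear_tsum (f := fun t => mid (braid12 s (braid23 s (t ⊗ c))))); last first.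
  by apply: linear_comp => //; apply: linear_comp => //; apply: linear_comp => //; lin.
rewrite (linear_tsum (f := fun t => mid (braid23 s (braid12 s t)))); last first.
  by apply: linear_comp => //; apply: linear_comp.
move=> e; transitivity (\tsum_(p, q <- s (a ⊗ b)) mid (braid12 s (braid23 s (p ⊗ q ⊗ c)))).
  apply: tlift_ext => p q; rewrite braid23_tens.
  rewrite (linear_tsum (f := fun t => mid (braid12 s t))); last by apply: linear_comp.
  rewrite {1}/lact (linear_tsum (f := ract s p)); last by rewrite /ract; lin.
  apply: tlift_ext => u v; rewrite mid12.
  by rewrite (linear_scale _ _ (ract_bilin.2 p)).
rewrite e; apply: tlift_ext => p q; rewrite braid12_tens -(tlift_id (s (a ⊗ p))).
rewrite (linear_tsum (f := fun t => mid (braid23 s (t ⊗ q)))); last first.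
  by apply: linear_comp => //; apply: linear_comp => //; lin.
rewrite [ract s a p]/ract (linear_tsum (f := fun x => lact s x q)); last first.
  by rewrite /lact; lin.
apply: tlift_ext => u v; rewrite mid23.
by rewrite (linear_scale _ _ (lact_bilin.1 q)).
Qed.

(** The antipode is used only through R(x, S y1 y2) = ε(y) x = R(x, y1 S y2). *)
Lemma braiding_calculus (D C : H -> H -> H) :
  (forall x y, D x y = ract s x (antipode y)) -> bilin C ->
  (forall x y, C x y = \tsum_(a, b <- comul x) lact s (D y a) b) ->
  braid_calculus (fun x : H => comul x) (fun x : H => counit x) 1
    (fun x y : H => x * y) (lact s) (ract s) D C (fun x y : H => s (x ⊗ y)).
Proof.
move=> DE bC CE.
have bD : bilin D.
  by split=> ? ? ? ? /=; rewrite !DE ?linearP ?ract_bilin.1 ?ract_bilin.2.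
split=> //.
- by lin.
- by lin.
- by lin.
- exact: lact_bilin.
- exact: ract_bilin.
- by lin.
- by move=> W f x; apply: comulA_sum.
- exact: counitl.
- exact: counitr.
- exact: comul1.
- exact: counit1.
- exact: comulM.
- exact: counitM.
- exact: counit_lact.
- exact: counit_ract.
- exact: comul_lact.
- exact: comul_ract.
- exact: braid_comul.
- exact: braid_comul_swapped.
- exact: lact_one.
- exact: ract_one.
- exact: one_ract.
- exact: mul_lact.
- exact: ract_mul.
- exact: mul_ract.
- exact: lact_mul.
- exact: braid_middle.
- move=> x y; rewrite -[in RHS](ract_one x) -(linear_scale _ _ (ract_bilin.2 x)).
  rewrite -antipoder (linear_tsum (f := ract s x)); last exact: ract_bilin.2.
  by apply: tlift_ext => a b; rewrite DE ract_mul.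
- move=> x y; rewrite -[in RHS](ract_one x) -(linear_scale _ _ (ract_bilin.2 x)).
  rewrite -antipodel (linear_tsum (f := ract s x)); last exact: ract_bilin.2.
  by apply: tlift_ext => a b; rewrite DE ract_mul.
Qed.

(** * The associated Hopf q-brace *)

Definition braid_Ginv (t : H ⊗ H) : H ⊗ H :=
  \tsum_(h, l <- t) \tsum_(a, b <- comul l) ract s h (antipode a) ⊗ b.

Lemma braid_Ginv_linear : linear braid_Ginv.
Proof. by rewrite /braid_Ginv /ract; lin. Qed.

Lemma braid_G_tens h l : braid_G s (h ⊗ l) = \tsum_(a, b <- comul l) ract s h a ⊗ b.
Proof. by rewrite /braid_G tlift_tens // /ract; lin. Qed.

Lemma braid_Ginv_tens h l :
  braid_Ginv (h ⊗ l) = \tsum_(a, b <- comul l) ract s h (antipode a) ⊗ b.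
Proof. by rewrite /braid_Ginv tlift_tens // /ract; lin. Qed.

(* The calculus with the explicit inverse of R serves to invert braid_G, and only
   then can assoc_dot be identified with this inverse. *)
Let D0 (x y : H) := ract s x (antipode y).
Let C0 (x y : H) := \tsum_(a, b <- comul x) lact s (D0 y a) b.
Let calculus0 : braid_calculus (fun x : H => comul x) (fun x : H => counit x) 1
    (fun x y : H => x * y) (lact s) (ract s) D0 C0 (fun x y : H => s (x ⊗ y)).
Proof. by apply: braiding_calculus => //; rewrite /C0 /D0 /lact /ract; lin. Qed.

Lemma braid_GK : cancel (braid_G s) braid_Ginv.
Proof.
apply: tensor_lin_ext; [|by []|move=> h l].
  by apply: linear_comp; [exact: braid_Ginv_linear | exact: linearP].
rewrite braid_G_tens (linear_tsum (f := braid_Ginv)); last exact: braid_Ginv_linear.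
under tlift_ext => a b do rewrite braid_Ginv_tens.
rewrite -[RHS](sw_DRl calculus0 _ _ (tens_bilin H H)) comulA_sum //.
all: by rewrite /D0 /ract; lin.
Qed.

Lemma braid_GVK : cancel braid_Ginv (braid_G s).
Proof.
apply: tensor_lin_ext; [|by []|move=> h l].
  by apply: linear_comp; [exact: linearP | exact: braid_Ginv_linear].
rewrite braid_Ginv_tens (linear_tsum (f := braid_G s)); last exact: linearP.
under tlift_ext => a b do rewrite braid_G_tens.
rewrite -[RHS](sw_RDl calculus0 _ _ (tens_bilin H H)) comulA_sum //.
all: by rewrite /D0 /ract; lin.
Qed.

Lemma braid_G_bij : bijective (braid_G s).
Proof. exact: Bijective braid_GK braid_GVK. Qed.

Lemma lininv_braid_G t : lininv (braid_G s) t = braid_Ginv t.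
Proof.
by apply: (bij_inj braid_G_bij); rewrite braid_GVK lininvKV //; exact: braid_G_bij.
Qed.

Lemma assoc_dotE x y : assoc_dot s (x ⊗ y) = ract s x (antipode y).
Proof.
rewrite /assoc_dot lininv_braid_G braid_Ginv_tens tlift_tlift; last by lin.
rewrite -[RHS](sw_epsr calculus0 (f := fun z => ract s x (antipode z))); last first.
  by rewrite /ract; lin.
by apply: tlift_ext => a b; rewrite tlift_tens //; lin.
Qed.

Lemma assoc_colonE x y :
  assoc_colon s (x ⊗ y) = \tsum_(a, b <- comul x) lact s (assoc_dot s (y ⊗ a)) b.
Proof. by rewrite /assoc_colon tlift_tens // /lact; lin. Qed.

Lemma associated_calculus :
  braid_calculus (fun x : H => comul x) (fun x : H => counit x) 1
    (fun x y : H => x * y) (lact s) (ract s)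
    (fun x y : H => assoc_dot s (x ⊗ y)) (fun x y : H => assoc_colon s (x ⊗ y))
    (fun x y : H => s (x ⊗ y)).
Proof.
apply: braiding_calculus; [exact: assoc_dotE | by lin | exact: assoc_colonE].
Qed.

Lemma qbrace_G_bij : bijective (qbrace_G (assoc_dot s)).
Proof.
have e t : qbrace_G (assoc_dot s) t = braid_Ginv t.
  rewrite /qbrace_G /braid_Ginv; do 2!apply: tlift_ext => ? ?.
  by rewrite /= assoc_dotE.
exists (braid_G s) => t; rewrite e; [exact: braid_GVK | exact: braid_GK].
Qed.

Lemma braiding_skewP :
  (forall t, tmul (s t) = tmul t) <->
  skew_compatible (fun x : H => comul x) (fun x y : H => x * y)
    (fun x y : H => assoc_dot s (x ⊗ y)) (fun x y : H => assoc_colon s (x ⊗ y)).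
Proof.
rewrite -(skew_compatibleP associated_calculus); split=> [e x y|e].
  by rewrite -tmul_tens -e.
apply: tensor_lin_ext; [by lin | by lin | move=> x y].
by rewrite tmul_tens -e.
Qed.

Lemma qbrace_pairing_tens (dot colon : {linear (H ⊗ H)%type -> H}) (x : H) (y : H^cop) :
  qbrace_pairing dot colon (x ⊗ y) =
  \tsum_(a, b <- comul x) \tsum_(c, d <- comul (y : H))
    (colon (c ⊗ b) : H^cop) ⊗ dot (a ⊗ d).
Proof. by rewrite /qbrace_pairing tlift_tens //; lin. Qed.

Lemma tsum_comul_cop (W : lmodType k) (f : H^cop -> H^cop -> W) (x : H^cop) :
  bilin f -> tlift f (comul x) = \tsum_(a, b <- comul (x : H)) f b a.
Proof.
move=> bf; rewrite [comul x]/(cop_comul x) /cop_comul /tswap tlift_tlift //.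
by apply: tlift_ext => a b; rewrite tlift_tens.
Qed.

Lemma associated_pairing :
  coalg_morphism (qbrace_pairing (assoc_dot s) (assoc_colon s)).
Proof.
have BC := associated_calculus.
pose dot (x y : H) := assoc_dot s (x ⊗ y).
pose colon (x y : H) : H^cop := assoc_colon s (x ⊗ y).
have fE (x : H) (y : H^cop) : qbrace_pairing (assoc_dot s) (assoc_colon s) (x ⊗ y) =
    \tsum_(a, b <- comul x) \tsum_(c, d <- comul (y : H)) colon c b ⊗ dot a d.
  exact: qbrace_pairing_tens.
pose F : {linear (H ⊗ H^cop)%type -> (H^cop ⊗ H)%type} :=
  qbrace_pairing (assoc_dot s) (assoc_colon s).
have lF : linear F by exact: linearP.
have bFF : bilin (fun u v => F u ⊗ F v).
  by split=> v; [apply: lin_tensl | apply: lin_tensr].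
rewrite -/F; split.
  apply: tensor_lin_ext => [||x y].
  - by apply: linear_comp => //; exact: linearP.
  - by apply: linear_comp; [exact: linearP | exact: linearP].
  transitivity (\tsum_(a, b <- comul x) \tsum_(c, d <- comul (y : H))
      \tsum_(a1, a2 <- comul (colon c b : H)) \tsum_(b1, b2 <- comul (dot a d))
        ((a2 : H^cop) ⊗ b1) ⊗ ((a1 : H^cop) ⊗ b2)).
    rewrite [F _]fE linear_tlift; apply: tlift_ext => a b.
    rewrite linear_tlift; apply: tlift_ext => c d.
    rewrite -[LHS]tlift_id tsum_comul_tens; last by lin.
    by rewrite tsum_comul_cop //; lin.
  rewrite /tmap tsum_comul_tens //.
  apply: etrans (sw_pairing BC x y (tens_bilin H^cop H) (tens_bilin H^cop H)
      (tens_bilin _ _)) _.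
  apply: tlift_ext => a b; rewrite tsum_comul_cop; last first.
    apply: lin_bilin => u; first by apply/(linear_comp (bFF.1 _))/lin_tensr.
    by apply/(linear_comp (bFF.2 _))/lin_tensr.
  apply: tlift_ext => c d.
  rewrite [X in _ = X ⊗ _]fE [X in _ = _ ⊗ X]fE tens_tlift.
  apply: tlift_ext => a' b'; rewrite [LHS]tlift_exchange.
  by apply: tlift_ext => a'' b''; rewrite tens_tlift.
apply: (@tensor_lin_ext k H H^cop k^o (fun t => counit (F t)) (fun t => counit t)).
- by apply: linear_comp => //; exact: linearP.
- exact: linearP.
move=> x y.
rewrite [F _]fE linear_tlift [RHS]tens_counitE.
rewrite -[RHS](sw_epsl BC (f := fun b : H => (counit b : k) *: (counit (y : H) : k^o)));
  last by lin.
apply: eq_bigr => p _ /=; rewrite linear_tlift.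
rewrite -[in RHS](sw_epsl BC (f := fun d : H => (counit d : k^o)) y); last by lin.
rewrite -!tsum_scaler.
apply: eq_bigr => q _ /=; rewrite [LHS]tens_counitE.
rewrite /colon /dot [X in X * _](eps_colon BC) [X in _ * X](eps_dot BC) /=.
have mulk (a b c d : k) : a * b * (c * d) = c * (b * (a * d)).
  by rewrite mulrCA [a * b]mulrC -mulrA.
exact: mulk.
Qed.

Lemma associated_hopf_skew_brace :
  (forall t, tmul (s t) = tmul t) -> hopf_skew_brace (assoc_dot s) (assoc_colon s).
Proof.
move=> /braiding_skewP skew; have BC := associated_calculus; split; last first.
  by move=> h m; apply: skew.
split.
- exact: eps_dot BC.
- exact: eps_colon BC.
- exact: associated_pairing.
- exact: qbrace_G_bij.
- exact: dot_dot BC skew.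
- exact: dot_colon BC skew.
- exact: colon_colon BC skew.
- by split; [exact: dot_one BC | move=> m a b; exact: (dot_mul BC m b a)].
- by split; [exact: colon_one BC | move=> m a b; exact: (colon_mul BC m a b)].
- exact: mul_dot BC.
- exact: mul_colon BC.
Qed.

End BraidingActions.

Theorem proposition6p4 (k : fieldType) (H : hopfAlgType k)
    (s : {linear (H ⊗ H)%type -> (H ⊗ H)%type}) :
  weak_braiding_operator s ->
  (braiding_operator s <-> hopf_skew_brace (assoc_dot s) (assoc_colon s)).
Proof.
move=> ws; split=> [[_ e]|[_ skew]]; first exact: associated_hopf_skew_brace.
by split=> //; apply/(braiding_skewP ws) => h m; apply: skew.
Qed.
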